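(* Let $\tilde f_0\colon(\mathbb{C},0)\to(\mathbb{C},0)$ be an antiholomorphic parabolic germ of codimension $1$ with formal invariant $b_0\in\mathbb{R}$. Let $\tilde f_\eta$ be a generic unfolding of $\tilde f_0$ depending on the real parameter $\eta$, with fixed points at $z^2=\eta$. Let $\tilde g_\eta=\tilde f_\eta\circ\tilde f_\eta$ and set $$\varepsilon:=\left(\frac{1}{\log(\tilde g_\eta'(\sqrt\eta))}-\frac{1}{\log(\tilde g_\eta'(-\sqrt\eta))}\right)^{-2},\qquad b:=\frac{1}{\log(\tilde g_\eta'(\sqrt\eta))}+\frac{1}{\log(\tilde g_\eta'(-\sqrt\eta))},$$ where $\log$ is the principal branch. Then, as functions of $\eta$, $\varepsilon$ and $b$ 1. are real-valued; 2. are invariant under changes of coordinate (i.e. they take the same values when $\tilde f_\eta$ is replaced by a family conjugate to it by mix analytic local changes of the coordinate $z$, the derivatives being taken at the corresponding fixed points of the second iterate); 3. can be continued (to $\eta=0$) into real analytic functions; in particular $\varepsilon(0)=0$ and $b(0)=b_0$.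
   Context: A function $f$ of one complex variable is antiholomorphic if $\partial f/\partial z\equiv0$, i.e. it is locally a convergent power series in $\bar z$. An antiholomorphic parabolic germ of codimension $1$ is a germ $f_0\colon(\mathbb{C},0)\to(\mathbb{C},0)$ of antiholomorphic diffeomorphism with $|\partial f_0/\partial\bar z(0)|=1$, for which $0$ is an isolated fixed point of multiplicity $2$. In a suitable holomorphic coordinate $$f_0(z)=\bar z+\tfrac12\bar z^2+\left(\tfrac14-\tfrac{b_0}{2}\right)\bar z^3+o(\bar z^3),\qquad b_0\in\mathbb{R};$$ the number $b_0$ is the formal invariant of $f_0$, and $f_0$ is always assumed to be written in such a coordinate. A function $f(t,z)$ of $t\in\mathbb{R}^n$ and $z\in\mathbb{C}^m$ is mix analytic (resp. mix anti-analytic) if near every point $(t^*,z^* )$ it is given by a convergent power series in $t-t^*$ and $z-z^*$ (resp. in $t-t^*$ and $\bar z-\bar z^*$). An unfolding of $f_0$ is a germ of mix anti-analytic diffeomorphism $f\colon(\mathbb{R},0)\times(\mathbb{C},0)\to(\mathbb{C},0)$, $(\eta,z)\mapsto f_\eta(z)$, equal to $f_0$ at $\eta=0$, so that $f_\eta(z)=f_0(z)+\sum_{j\ge0}a_j(\eta)\bar z^j$ with $a_j(0)=0$. It is generic if $\frac{d\,\mathrm{Re}(a_0)}{d\eta}(0)\neq0$. ''With fixed points at $z^2=\eta$'' means that the fixed points of $\tilde f_\eta$, when they exist ($\eta\ge0$), are $\pm\sqrt\eta$; for $\eta<0$ the points $\pm\sqrt\eta$ form a periodic orbit of period $2$, so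 $\pm\sqrt\eta$ are fixed points of the holomorphic map $\tilde g_\eta$ for all $\eta$. The parameter $\varepsilon$ is called the canonical parameter and the function $b$ the formal invariant of the family. *)

(* Defs.v *)
(* Stdlib reals with Coquelicot.  Germs at the origin are represented by total
   functions, of which only the values near the origin are ever used. *)
From Stdlib Require Import Reals.
From Coquelicot Require Import Coquelicot.
Open Scope C_scope.

Definition near_origin (P : R -> C -> Prop) : Prop :=
  locally (T := prod_UniformSpace R_UniformSpace C_UniformSpace)
    (0%R, RtoC 0) (fun p => P (fst p) (snd p)).

Definition little_o (f g : C -> C) : Prop :=
  is_domin (U := C_NormedModule) (V := C_NormedModule)
    (locally (RtoC 0)) g f.

(* The square root of a real number: [sqrt] vanishes on negative numbers, so
   this is sqrt eta for eta >= 0 and i * sqrt (- eta) for eta < 0. *)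
Definition csqrt (eta : R) : C := (sqrt eta, sqrt (- eta)).

(* The principal argument, in (-PI, PI], and the principal logarithm; both are
   meaningful for z <> 0 only. *)
Definition Carg (z : C) : R :=
  if Rle_dec 0 (Im z) then acos (Re z / Cmod z)
  else (- acos (Re z / Cmod z))%R.

Definition Clog (z : C) : C := (ln (Cmod z), Carg z).

(** Analyticity *)

(* A double series converges when it converges absolutely; its sum is then the
   limit of its square partial sums. *)
Definition is_double_series (a : nat -> nat -> C) (l : C) : Prop :=
  (exists M : R, forall N : nat,
      (sum_n (fun j => sum_n (fun k => Cmod (a j k)) N) N <= M)%R) /\
  filterlim (fun N => sum_n (fun j => sum_n (fun k => a j k) N) N)
    eventually (locally l).

Definition mix_analytic_at (f : R -> C -> C) (t0 : R) (z0 : C) : Prop :=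
  exists (c : nat -> nat -> C) (r : R), (0 < r)%R /\
    forall (t : R) (z : C), (Rabs (t - t0) < r)%R -> (Cmod (z - z0) < r)%R ->
      is_double_series
        (fun j k => c j k * (RtoC t - RtoC t0) ^ j * (z - z0) ^ k) (f t z).

Definition mix_anti_analytic_at (f : R -> C -> C) (t0 : R) (z0 : C) : Prop :=
  exists (c : nat -> nat -> C) (r : R), (0 < r)%R /\
    forall (t : R) (z : C), (Rabs (t - t0) < r)%R -> (Cmod (z - z0) < r)%R ->
      is_double_series
        (fun j k => c j k * (RtoC t - RtoC t0) ^ j * (Cconj z - Cconj z0) ^ k)
        (f t z).

Definition real_analytic_at (u : R -> R) (x0 : R) : Prop :=
  exists (a : nat -> R) (r : R), (0 < r)%R /\
    forall x : R, (Rabs (x - x0) < r)%R -> is_pseries a (x - x0)%R (u x).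

(* f is real-differentiable at z, with df/dz = p and df/dzbar = q there. *)
Definition wirtinger (f : C -> C) (z p q : C) : Prop :=
  filterdiff (K := R_AbsRing) (U := C_R_NormedModule) (V := C_R_NormedModule)
    f (locally z) (fun h => p * h + q * Cconj h).

Definition antiholomorphic_near_0 (f : C -> C) : Prop :=
  locally (RtoC 0) (fun z : C => exists q : C, wirtinger f z 0 q).

(** Antiholomorphic parabolic germs *)

(* f - id is not holomorphic.  Viewing z and zbar as independent variables,
   the fixed point equation of an antiholomorphic f becomes equivalent to
   f (f z) = z, so the multiplicity of the fixed point is the order of
   vanishing of f o f - id. *)
Definition fixed_point_multiplicity (f : C -> C) (m : nat) : Prop :=
  exists c : C, c <> 0 /\
    little_o (fun z => f (f z) - z - c * z ^ m) (fun z => z ^ m).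

Definition antiholomorphic_parabolic_codim1 (f0 : C -> C) : Prop :=
  antiholomorphic_near_0 f0 /\
  f0 0 = 0 /\
  (exists q : C, wirtinger f0 0 0 q /\ Cmod q = 1%R) /\
  locally (RtoC 0) (fun z : C => f0 z = z -> z = 0) /\
  fixed_point_multiplicity f0 2.

(* The coordinate is normalised up to order 3, with formal invariant b0. *)
Definition has_formal_invariant (f0 : C -> C) (b0 : R) : Prop :=
  little_o
    (fun z => f0 z - (Cconj z + / 2 * Cconj z ^ 2
                      + (/ 4 - RtoC b0 / 2) * Cconj z ^ 3))
    (fun z => Cconj z ^ 3).

(** Unfoldings *)

(* A family of diffeomorphisms fibred over the parameter: by the inverse
   function theorem, it is enough to look at the derivative of f 0 at 0. *)
Definition mix_anti_analytic_diffeo (f : R -> C -> C) : Prop :=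
  mix_anti_analytic_at f 0 0 /\
  f 0%R 0 = 0 /\
  (exists q : C, wirtinger (f 0%R) 0 0 q /\ q <> 0).

Definition unfolding (f0 : C -> C) (f : R -> C -> C) : Prop :=
  mix_anti_analytic_diffeo f /\
  locally (RtoC 0) (fun z : C => f 0%R z = f0 z).

Definition generic (f0 : C -> C) (f : R -> C -> C) : Prop :=
  exists a : nat -> R -> C,
    near_origin (fun eta z =>
      is_pseries (K := C_AbsRing) (V := C_NormedModule)
        (fun j => a j eta) (Cconj z) (f eta z - f0 z)) /\
    (forall j : nat, a j 0%R = 0) /\
    (exists l : R, is_derive (fun eta => Re (a O eta)) 0%R l /\ l <> 0%R).

Definition fixed_points_at_sqrt (f : R -> C -> C) : Prop :=
  near_origin (fun eta z =>
    f eta z = z <-> (0 <= eta)%R /\ (z = csqrt eta \/ z = - csqrt eta)) /\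
  locally 0%R (fun eta => (eta < 0)%R ->
    f eta (csqrt eta) = - csqrt eta /\ f eta (- csqrt eta) = csqrt eta).

Definition second_iterate (f : R -> C -> C) (eta : R) (z : C) : C :=
  f eta (f eta z).

Definition mix_analytic_change (h : R -> C -> C) : Prop :=
  mix_analytic_at h 0 0 /\
  h 0%R 0 = 0 /\
  (exists l : C, is_derive (K := C_AbsRing) (V := C_NormedModule)
                   (h 0%R) (RtoC 0) l /\ l <> 0).

Definition conjugate_by (h f1 f2 : R -> C -> C) : Prop :=
  near_origin (fun eta z => f2 eta (h eta z) = h eta (f1 eta z)).

(** The canonical parameter and the formal invariant, read from the
    derivatives of g at the points p and q *)

Definition log_mult (g : C -> C) (p : C) : C := Clog (C_derive g p).

Definition eps_of (g : C -> C) (p q : C) : C :=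
  / ((/ log_mult g p - / log_mult g q) ^ 2).

Definition b_of (g : C -> C) (p q : C) : C :=
  / log_mult g p + / log_mult g q.

(* [C_derive] and the inverse are total functions; under these conditions the
   formulas above do not involve any default value. *)
Definition log_mult_defined (g : C -> C) (p : C) : Prop :=
  ex_derive (K := C_AbsRing) (V := C_NormedModule) g p /\
  ~ (Im (C_derive g p) = 0%R /\ (Re (C_derive g p) <= 0)%R) /\
  log_mult g p <> 0.

Definition eps_b_defined (g : C -> C) (p q : C) : Prop :=
  log_mult_defined g p /\ log_mult_defined g q /\
  / log_mult g p - / log_mult g q <> 0.

(* Main.v *)
Require Import Defs.
From Stdlib Require Import Reals Lra Lia.
From Coquelicot Require Import Coquelicot.

Open Scope R_scope.

(** Write [f_t(z) = F(t, conj z)] with [F] a convergent power series in [(t, w)],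
    and let [D] be the derivative of [F] in [w].  For [s = +-sqrt t] the map
    [f_t] sends [s] to [conj s]: both points are fixed and real if [t > 0],
    exchanged and imaginary if [t < 0].  Hence the chain rule for
    [g_t(z) = F(t, conj (F(t, conj z)))] gives in both cases the multiplier
    [g_t'(s) = D(t, s) * conj (D(t, conj s))]
    ([taylor2_second_iterate], [acts_as_conjugation]).

    Now put [t = s^2] and split [D(s^2, s) = U(t) + s V(t)] into even and odd
    parts in [s], with [U] and [V] analytic in [t].  The multiplier becomes
    [(U + s V) (conj U + s conj V) = A(t) + s B(t)], where
    [A = |U|^2 + t |V|^2] and [B = 2 Re (U conj V)] are real analytic
    ([multiplier_expansion]).  Everything else is about this one formula.  With
    [T = B / A], the addition theorems for the logarithm on the real axis and for
    the argument on the imaginary one both read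
    [log (A +- s B) = P +- s Q], [P = ln (A^2 - t B^2) / 2],
    [Q = T phi(t T^2)], where [phi(x) = sum_n x^n / (2 n + 1)] is
    artanh(sqrt x) / sqrt x, that is, arctan(sqrt (-x)) / sqrt (-x) for [x < 0]
    ([Clog_even_odd]).  Since [P] vanishes at 0, [P = t P1], and
    [1/(P + s Q) + 1/(P - s Q) = 2 P1 / W] and
    [(1/(P + s Q) - 1/(P - s Q))^(-2) = t W^2 / (4 Q^2)] with
    [W = t P1^2 - Q^2].  The denominators do not vanish at 0 because
    [Q(0) = B(0) / A(0) = 2], so both expressions are real and real analytic in
    [t] ([canonical_invariants]).

    For the value at 0 of the second invariant one needs [P1(0) = A'(0) - 2].
    The normal form of [f_0] gives the coefficients of [w], [w^2], [w^3] in [F];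
    the coefficient of [t w] also enters [A'(0)], and it is the opposite of that
    of [w^3], because [f_t] fixes [+-sqrt t] for [t > 0], which forces the odd
    part of [F(s^2, s)] to be exactly [s] ([odd_part_identity]).  The outcome is
    [A'(0) = 2 - 2 b0].

    Invariance is the chain rule: a change of coordinate [h] conjugates the
    second iterates, and its derivative, non-zero near the origin, cancels at a
    fixed point ([multiplier_conjugacy_invariant]).

    The analysis rests on two devices.  Coefficients are controlled by geometric
    bounds [C r^n], under which double series may be summed along antidiagonals
    ([double_sum_antidiagonals]); this yields at once the composition of analytic
    germs ([analytic_comp]) and the restriction of a series in [(t, w)] to the
    parabola [t = s^2].  Complex derivatives are replaced by expansions
    with a quadratic remainder ([taylor2]), which power series satisfy by
    termwise estimates and which compose, also with complex conjugation. *)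

(** * Geometrically dominated series and double series *)

Lemma is_series_geom_scal (C q : R) :
  0 <= q < 1 -> is_series (fun n => C * q ^ n) (C * / (1 - q)).
Proof.
  intros Hq.
  apply (is_series_scal_l (K := R_AbsRing) (V := R_NormedModule) C
           (fun n => q ^ n) (/ (1 - q))).
  apply is_series_geom.
  rewrite Rabs_pos_eq; lra.
Qed.

Lemma ex_series_geom_dominated (a : nat -> R) (C q : R) :
  0 <= q < 1 -> (forall n, Rabs (a n) <= C * q ^ n) -> ex_series a.
Proof.
  intros Hq Ha.
  apply (ex_series_le (K := R_AbsRing) (V := R_CompleteNormedModule)
           a (fun n => C * q ^ n)).
  - exact Ha.
  - eexists. apply is_series_geom_scal, Hq.
Qed.

Lemma Series_geom_dominated (a : nat -> R) (C q : R) :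
  0 <= q <= / 2 -> (forall n, Rabs (a n) <= C * q ^ n) ->
  Rabs (Series a) <= 2 * C.
Proof.
  intros Hq Ha.
  assert (HC : 0 <= C).
  { specialize (Ha O). pose proof (Rabs_pos (a O)). simpl in Ha. lra. }
  assert (Hex : ex_series (fun n => C * q ^ n)).
  { eexists. apply is_series_geom_scal. lra. }
  assert (Habs : ex_series (fun n => Rabs (a n))).
  { apply (ex_series_geom_dominated _ C q). lra.
    intros n. rewrite Rabs_Rabsolu. apply Ha. }
  apply Rle_trans with (1 := Series_Rabs a Habs).
  apply Rle_trans with (Series (fun n => C * q ^ n)).
  { apply Series_le; auto. intros n. split. apply Rabs_pos. apply Ha. }
  rewrite (is_series_unique _ _ (is_series_geom_scal C q ltac:(lra))).
  assert (/ (1 - q) <= 2).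
  { rewrite <- (Rinv_inv 2). apply Rinv_le_contravar; lra. }
  nra.
Qed.

Lemma Series_tail_geom_dominated (a : nat -> R) (C q : R) (m : nat) :
  0 <= q <= / 2 -> (forall n, Rabs (a n) <= C * q ^ n) ->
  Rabs (Series a - sum_n a m) <= 2 * C * q ^ S m.
Proof.
  intros Hq Ha.
  assert (Hex : ex_series a) by (apply (ex_series_geom_dominated _ C q); auto; lra).
  rewrite (Series_incr_n a (S m)) by (auto; lia).
  replace (pred (S m)) with m by reflexivity.
  rewrite <- (sum_n_Reals a m).
  replace (_ - _) with (Series (fun k => a (S m + k)%nat)) by ring.
  apply Rle_trans with (2 * (C * q ^ S m)); [|right; ring].
  apply Series_geom_dominated with q; auto.
  intros n. rewrite Rmult_assoc, <- pow_add. apply Ha.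
Qed.

Lemma sum_n_abs_le (a : nat -> R) (B : R) (N : nat) :
  (forall k, (k <= N)%nat -> Rabs (a k) <= B) ->
  Rabs (sum_n a N) <= INR (S N) * B.
Proof.
  intros H. induction N as [|N IH].
  - rewrite sum_O. simpl. rewrite Rmult_1_l. apply H; lia.
  - rewrite sum_Sn, (S_INR (S N)). unfold plus; simpl.
    apply Rle_trans with (1 := Rabs_triang _ _).
    specialize (IH (fun k Hk => H k ltac:(lia))).
    specialize (H (S N) ltac:(lia)). simpl in IH. lra.
Qed.

Lemma INR_le_pow2 (n : nat) : INR n <= 2 ^ n.
Proof.
  induction n as [|n IH]; [simpl; lra|].
  rewrite S_INR. simpl. pose proof (pow_R1_Rle 2 n ltac:(lra)). lra.
Qed.

Lemma is_lim_seq_geom_half (C : R) : is_lim_seq (fun N => C * (/ 2) ^ S N) 0.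
Proof.
  apply (is_lim_seq_incr_1 (fun N => C * (/ 2) ^ N)).
  replace (Finite 0) with (Rbar_mult C 0) by (simpl; f_equal; ring).
  apply is_lim_seq_scal_l, is_lim_seq_geom.
  rewrite Rabs_pos_eq; lra.
Qed.

(** The columns may be truncated at any height [m N k], as long as the entries
    left out all lie beyond the [N]-th antidiagonal: there the entries are of
    size [O(4^-N)], while there are only [N + 1 <= 2^(N+1)] columns. *)
Lemma double_sum_exhaustion (a : nat -> nat -> R) (C q : R)
    (m : nat -> nat -> nat) :
  0 <= q <= / 4 -> (forall j k, Rabs (a j k) <= C * q ^ (j + k)) ->
  (forall N k, (k <= N)%nat -> (N <= m N k + k)%nat) ->
  is_lim_seq (fun N => sum_n (fun k => sum_n (fun j => a j k) (m N k)) N)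
    (Series (fun k => Series (fun j => a j k))).
Proof.
  intros Hq Ha Hm.
  assert (HC : 0 <= C).
  { specialize (Ha O O). pose proof (Rabs_pos (a O O)). simpl in Ha. lra. }
  assert (Hcol : forall k j, Rabs (a j k) <= (C * q ^ k) * q ^ j).
  { intros k j. apply Rle_trans with (1 := Ha j k). rewrite pow_add. right; ring. }
  assert (Hser : ex_series (fun k => Series (fun j => a j k))).
  { apply (ex_series_geom_dominated _ (2 * C) q). lra.
    intros k. rewrite Rmult_assoc. apply Series_geom_dominated with q. lra. auto. }
  set (S1 := fun N => sum_n (fun k => Series (fun j => a j k)) N).
  set (d := fun N =>
    sum_n (fun k => Series (fun j => a j k) - sum_n (fun j => a j k) (m N k)) N).
  assert (Hd : is_lim_seq d 0).
  { apply is_lim_seq_abs_0.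
    apply is_lim_seq_le_le with (fun _ => 0) (fun N => (2 * C) * (/ 2) ^ S N).
    2: apply is_lim_seq_const.
    2: apply is_lim_seq_geom_half.
    intros N. split; [apply Rabs_pos|].
    apply Rle_trans with (INR (S N) * (2 * C * q ^ S N)).
    - apply sum_n_abs_le. intros k Hk.
      apply Rle_trans with (2 * (C * q ^ k) * q ^ S (m N k)).
      { apply Series_tail_geom_dominated. lra. auto. }
      replace (2 * (C * q ^ k) * q ^ S (m N k))
        with (2 * C * q ^ (S (m N k) + k)) by (rewrite pow_add; ring).
      apply Rmult_le_compat_l; [lra|].
      specialize (Hm N k Hk).
      replace (S (m N k) + k)%nat with (S N + (m N k + k - N))%nat by lia.
      rewrite pow_add. rewrite <- (Rmult_1_r (q ^ S N)) at 2.
      apply Rmult_le_compat_l; [apply pow_le; lra|].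
      rewrite <- (pow1 (m N k + k - N)). apply pow_incr; lra.
    - replace (INR (S N) * (2 * C * q ^ S N))
        with ((2 * C) * (INR (S N) * q ^ S N)) by ring.
      apply Rmult_le_compat_l; [lra|].
      apply Rle_trans with (2 ^ S N * (/ 4) ^ S N).
      + apply Rmult_le_compat; auto using pos_INR, INR_le_pow2.
        apply pow_le; lra. apply pow_incr; lra.
      + rewrite <- Rpow_mult_distr. right. f_equal. lra. }
  apply is_lim_seq_ext with (fun N => S1 N - d N).
  { intros N. unfold S1, d.
    generalize (m N); intros p. clear.
    induction N as [|N IH]; [rewrite !sum_O; ring|].
    rewrite !sum_Sn. unfold plus in *; simpl in *. rewrite <- IH. ring. }
  replace (Series (fun k => Series (fun j => a j k)))
    with (Series (fun k => Series (fun j => a j k)) - 0) by ring.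
  apply is_lim_seq_minus'; auto.
  apply (Series_correct _ Hser).
Qed.

Lemma double_sum_squares (a : nat -> nat -> R) (C q : R) :
  0 <= q <= / 4 -> (forall j k, Rabs (a j k) <= C * q ^ (j + k)) ->
  is_lim_seq (fun N => sum_n (fun j => sum_n (fun k => a j k) N) N)
    (Series (fun k => Series (fun j => a j k))).
Proof.
  intros Hq Ha.
  apply is_lim_seq_ext with
    (fun N => sum_n (fun k => sum_n (fun j => a j k) N) N).
  { intros N. apply (sum_n_switch (fun k j => a j k)). }
  apply (double_sum_exhaustion a C q (fun N _ => N)); auto. intros; lia.
Qed.


Lemma double_sum_antidiagonals (a : nat -> nat -> R) (C q : R) :
  0 <= q <= / 4 -> (forall j k, Rabs (a j k) <= C * q ^ (j + k)) ->
  is_series (fun n => sum_n (fun k => a (n - k)%nat k) n)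
    (Series (fun k => Series (fun j => a j k))).
Proof.
  intros Hq Ha.
  assert (Htri : forall N,
    sum_n (fun k => sum_n (fun j => a j k) (N - k)) N =
    sum_n (fun n => sum_n (fun k => a (n - k)%nat k) n) N).
  { induction N as [|N IH]; [rewrite !sum_O; reflexivity|].
    rewrite (sum_Sn (fun n => sum_n (fun k => a (n - k)%nat k) n)), <- IH.
    rewrite !sum_Sn, Nat.sub_diag, sum_O, plus_assoc. f_equal.
    rewrite <- sum_n_plus. apply sum_n_ext_loc. intros k Hk.
    replace (S N - k)%nat with (S (N - k)) by lia.
    apply sum_Sn. }
  change (is_lim_seq (fun N => sum_n (fun n => sum_n (fun k => a (n - k)%nat k) n) N)
            (Series (fun k => Series (fun j => a j k)))).
  apply (is_lim_seq_ext _ _ _ Htri).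
  apply (double_sum_exhaustion a C q (fun N k => N - k)%nat Hq Ha).
  intros; lia.
Qed.

(** * Germs of real analytic functions at 0 *)

Definition geom_bounded (a : nat -> R) (C r : R) : Prop :=
  forall n, Rabs (a n) <= C * r ^ n.

Definition analytic (u : R -> R) : Prop := real_analytic_at u 0.

Lemma geom_bounded_nonneg a C r : geom_bounded a C r -> 0 <= C.
Proof.
  intros H. specialize (H O). pose proof (Rabs_pos (a O)). simpl in H. lra.
Qed.

Lemma geom_bounded_term a C r x n :
  geom_bounded a C r -> 0 <= r -> Rabs (a n * x ^ n) <= C * (r * Rabs x) ^ n.
Proof.
  intros H Hr. rewrite Rabs_mult, Rpow_mult_distr, <- RPow_abs, <- Rmult_assoc.
  apply Rmult_le_compat_r; [apply pow_le, Rabs_pos|apply H].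
Qed.

Lemma locally_0_abs (P : R -> Prop) :
  locally 0 P <-> exists d, 0 < d /\ forall x, Rabs x < d -> P x.
Proof.
  assert (Hball : forall (x e : R), ball 0 e x <-> Rabs x < e).
  { intros x e. change (Rabs (x - 0) < e <-> Rabs x < e).
    rewrite Rminus_0_r. reflexivity. }
  split.
  - intros [d H]. exists d. split; [apply cond_pos|].
    intros x Hx. apply H, Hball, Hx.
  - intros [d [Hd H]]. exists (mkposreal d Hd). intros x Hx.
    apply H, Hball, Hx.
Qed.

Lemma geom_bounded_CV_radius a C r x :
  geom_bounded a C r -> 0 < r -> r * Rabs x < / 2 ->
  Rbar_lt (Rabs x) (CV_radius a).
Proof.
  intros H Hr Hx.
  apply Rbar_lt_le_trans with (/ (2 * r)).
  - simpl. apply Rmult_lt_reg_l with r; auto.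
    replace (r * / (2 * r)) with (/ 2) by (field; lra). exact Hx.
  - apply CV_radius_bounded. exists C. intros n.
    apply Rle_trans with (1 := geom_bounded_term a C r _ n H ltac:(lra)).
    pose proof (geom_bounded_nonneg _ _ _ H).
    rewrite <- (Rmult_1_r C) at 2. apply Rmult_le_compat_l; auto.
    rewrite Rabs_pos_eq by (left; apply Rinv_0_lt_compat; lra).
    replace (r * / (2 * r)) with (/ 2) by (field; lra).
    rewrite <- (pow1 n). apply pow_incr; lra.
Qed.

Lemma geom_bounded_is_pseries a C r x :
  geom_bounded a C r -> 0 < r -> r * Rabs x < / 2 ->
  is_pseries a x (PSeries a x).
Proof.
  intros H Hr Hx. apply PSeries_correct, CV_radius_inside.
  apply geom_bounded_CV_radius with C r; auto.
Qed.

Lemma analytic_PSeries (u : R -> R) a C r :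
  geom_bounded a C r -> 0 < r -> locally 0 (fun x => u x = PSeries a x) ->
  analytic u.
Proof.
  intros Ha Hr Hu.
  apply locally_0_abs in Hu. destruct Hu as [d [Hd Hu]].
  exists a, (Rmin d (/ (2 * r))).
  assert (0 < / (2 * r)) by (apply Rinv_0_lt_compat; lra).
  split; [apply Rmin_glb_lt; lra|].
  intros x Hx. rewrite Rminus_0_r in *.
  assert (Rabs x < d) by (apply Rlt_le_trans with (1 := Hx), Rmin_l).
  assert (Rabs x < / (2 * r)) by (apply Rlt_le_trans with (1 := Hx), Rmin_r).
  rewrite Hu by auto. apply geom_bounded_is_pseries with C r; auto.
  apply Rmult_lt_reg_l with (/ r); [apply Rinv_0_lt_compat; lra|].
  rewrite <- Rmult_assoc, Rinv_l, Rmult_1_l by lra.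
  replace (/ r * / 2) with (/ (2 * r)) by (field; lra). auto.
Qed.

(** The terms of a convergent series are bounded, here at one point [y], which
    bounds the coefficients by a multiple of [y^(-n)]. *)
Lemma analytic_geom_PSeries (u : R -> R) :
  analytic u -> exists a C r,
    geom_bounded a C r /\ 1 <= r /\
    forall x, r * Rabs x < / 2 -> u x = PSeries a x.
Proof.
  intros [a [d [Hd H]]].
  set (y := Rmin (d / 2) 1).
  assert (Hy : 0 < y) by (apply Rmin_glb_lt; lra).
  assert (y <= d / 2) by apply Rmin_l.
  assert (y <= 1) by apply Rmin_r.
  assert (Hlim : ex_series (fun n => a n * y ^ n)).
  { exists (u y). apply is_pseries_R.
    rewrite <- (Rminus_0_r y) at 1. apply H.
    rewrite Rminus_0_r, Rabs_pos_eq; lra. }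
  apply ex_series_lim_0 in Hlim.
  assert (Hb : exists M, forall n, Rabs (a n * y ^ n) <= M).
  { destruct (filterlim_bounded (fun n => a n * y ^ n)) as [M HM].
    - exists 0. exact Hlim.
    - exists M. exact HM. }
  destruct Hb as [M HM].
  exists a, M, (/ y). split; [|split].
  - intros n. specialize (HM n).
    rewrite Rabs_mult, (Rabs_pos_eq (y ^ n)) in HM by (apply pow_le; lra).
    rewrite pow_inv.
    apply Rmult_le_reg_r with (y ^ n); [apply pow_lt; lra|].
    rewrite Rmult_assoc, Rinv_l, Rmult_1_r by (apply pow_nonzero; lra). exact HM.
  - rewrite <- Rinv_1. apply Rinv_le_contravar; lra.
  - intros x Hx. symmetry. apply is_pseries_unique.
    replace x with (x - 0) at 1 by ring. apply H.
    rewrite Rminus_0_r.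
    apply Rlt_le_trans with (y / 2); [|lra].
    apply Rmult_lt_reg_l with (/ y); [apply Rinv_0_lt_compat; lra|].
    replace (/ y * (y / 2)) with (/ 2) by (field; lra). exact Hx.
Qed.

Lemma locally_0_geom (r : R) : 0 < r -> locally 0 (fun x => r * Rabs x < / 2).
Proof.
  intros Hr. apply locally_0_abs. exists (/ (2 * r)).
  split; [apply Rinv_0_lt_compat; lra|].
  intros x Hx. apply Rmult_lt_reg_l with (/ r); [apply Rinv_0_lt_compat; lra|].
  rewrite <- Rmult_assoc, Rinv_l, Rmult_1_l by lra.
  replace (/ r * / 2) with (/ (2 * r)) by (field; lra). auto.
Qed.

Lemma analytic_ext_loc (u v : R -> R) :
  locally 0 (fun x => u x = v x) -> analytic u -> analytic v.
Proof.
  intros Huv Hu. destruct (analytic_geom_PSeries u Hu) as [a [C [r [Ha [Hr H]]]]].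
  apply analytic_PSeries with a C r; auto; try lra.
  generalize (filter_and _ _ Huv (locally_0_geom r ltac:(lra))).
  apply filter_imp. intros x [H1 H2]. rewrite <- H1; auto.
Qed.

Lemma analytic_ext (u v : R -> R) :
  (forall x, u x = v x) -> analytic u -> analytic v.
Proof. intros H. apply analytic_ext_loc, filter_forall, H. Qed.

Lemma analytic_is_derive (u : R -> R) :
  analytic u -> exists l, is_derive u 0 l.
Proof.
  intros Hu. destruct (analytic_geom_PSeries u Hu) as [a [C [r [Ha [Hr H]]]]].
  exists (PSeries (PS_derive a) 0).
  apply is_derive_ext_loc with (PSeries a).
  - generalize (locally_0_geom r ltac:(lra)). apply filter_imp.
    intros x Hx. symmetry. auto.
  - apply is_derive_PSeries, geom_bounded_CV_radius with C r; auto; try lra.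
    rewrite Rabs_R0. lra.
Qed.

Lemma analytic_continuous (u : R -> R) : analytic u -> continuous u 0.
Proof.
  intros Hu. destruct (analytic_is_derive u Hu) as [l Hl].
  apply (ex_derive_continuous u). exists l; auto.
Qed.


(** The Cauchy product needs points strictly inside the disc of convergence,
    whereas a representation is only known to converge: a slightly larger
    abscissa, where it still converges, shows that the radius is larger. *)
Lemma pseries_inside (u : R -> R) (a : nat -> R) (d : R) (x : R) :
  (forall x, Rabs (x - 0) < d -> is_pseries a (x - 0) (u x)) ->
  Rabs (x - 0) < d -> Rbar_lt (Rabs (x - 0)) (CV_radius a).
Proof.
  intros H Hx.
  set (y := (Rabs (x - 0) + d) / 2).
  assert (0 <= Rabs (x - 0)) by apply Rabs_pos.
  apply Rbar_lt_le_trans with (Finite y).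
  - simpl. unfold y. lra.
  - apply Rbar_not_lt_le. intros Hlt.
    apply (CV_disk_outside a y).
    + rewrite Rabs_pos_eq; auto. unfold y; lra.
    + apply ex_series_lim_0. exists (u y). apply is_pseries_R.
      replace y with (y - 0) at 1 by ring. apply H.
      rewrite Rminus_0_r, Rabs_pos_eq; unfold y; lra.
Qed.

Lemma analytic_plus u v : analytic u -> analytic v -> analytic (fun x => u x + v x).
Proof.
  intros [a [d [Hd Ha]]] [b [e [He Hb]]].
  exists (PS_plus a b), (Rmin d e). split; [apply Rmin_glb_lt; auto|].
  intros x Hx. apply (is_pseries_plus a b).
  - apply Ha, Rlt_le_trans with (1 := Hx), Rmin_l.
  - apply Hb, Rlt_le_trans with (1 := Hx), Rmin_r.
Qed.

Lemma analytic_mult u v : analytic u -> analytic v -> analytic (fun x => u x * v x).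
Proof.
  intros [a [d [Hd Ha]]] [b [e [He Hb]]].
  exists (PS_mult a b), (Rmin d e). split; [apply Rmin_glb_lt; auto|].
  intros x Hx.
  assert (Rabs (x - 0) < d) by (apply Rlt_le_trans with (1 := Hx), Rmin_l).
  assert (Rabs (x - 0) < e) by (apply Rlt_le_trans with (1 := Hx), Rmin_r).
  apply is_pseries_mult; auto; eapply pseries_inside; eauto.
Qed.

(** Both sides sum the double series [u j k x^(j+k)], by columns on the left and
    along antidiagonals on the right. *)
Lemma PSeries_antidiagonals (u : nat -> nat -> R) (C r x : R) :
  (forall j k, Rabs (u j k) <= C * r ^ (j + k)) -> 0 <= r -> r * Rabs x <= / 4 ->
  Series (fun k => x ^ k * PSeries (fun j => u j k) x) =
  PSeries (fun n => sum_n (fun k => u (n - k)%nat k) n) x.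
Proof.
  intros Hu Hr Hx.
  assert (Hq : 0 <= r * Rabs x <= / 4).
  { split; auto. apply Rmult_le_pos; auto. apply Rabs_pos. }
  assert (H := double_sum_antidiagonals (fun j k => u j k * x ^ (j + k)) C _ Hq).
  rewrite (Series_ext _ (fun k => Series (fun j => u j k * x ^ (j + k)))).
  2:{ intros k. unfold PSeries. rewrite <- Series_scal_l.
      apply Series_ext. intros j. rewrite pow_add. ring. }
  symmetry. apply is_series_unique.
  eapply is_series_ext; [|apply H].
  - intros n. rewrite <- (sum_n_mult_r (K := R_Ring)).
    apply sum_n_ext_loc. intros k Hk. unfold mult; simpl.
    f_equal. f_equal. lia.
  - intros j k. rewrite Rabs_mult, Rpow_mult_distr, <- RPow_abs, <- Rmult_assoc.
    apply Rmult_le_compat_r; auto. apply pow_le, Rabs_pos.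
Qed.

Lemma geom_bounded_antidiagonals (u : nat -> nat -> R) (C r : R) :
  (forall j k, Rabs (u j k) <= C * r ^ (j + k)) -> 0 <= r ->
  geom_bounded (fun n => sum_n (fun k => u (n - k)%nat k) n) (2 * C) (2 * r).
Proof.
  intros Hu Hr n.
  assert (HC : 0 <= C).
  { specialize (Hu O O). pose proof (Rabs_pos (u O O)). simpl in Hu. lra. }
  apply Rle_trans with (INR (S n) * (C * r ^ n)).
  - apply sum_n_abs_le. intros k Hk. specialize (Hu (n - k)%nat k).
    replace (n - k + k)%nat with n in Hu by lia. exact Hu.
  - rewrite Rpow_mult_distr.
    replace (2 * C * (2 ^ n * r ^ n)) with (2 ^ (S n) * (C * r ^ n)) by (simpl; ring).
    apply Rmult_le_compat_r.
    + apply Rmult_le_pos; auto. apply pow_le; auto.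
    + apply INR_le_pow2.
Qed.

Definition PS_const (c : R) (n : nat) : R := match n with O => c | S _ => 0 end.

Lemma is_pseries_const (c x : R) : is_pseries (PS_const c) x c.
Proof.
  apply is_pseries_R. unfold is_series.
  apply filterlim_ext with (fun _ : nat => c).
  - intros n. symmetry. induction n as [|n IH].
    + rewrite sum_O. simpl. ring.
    + rewrite sum_Sn, IH. unfold plus; simpl. ring.
  - apply filterlim_const.
Qed.

Lemma analytic_const (c : R) : analytic (fun _ => c).
Proof. exists (PS_const c), 1. split; [lra|]. intros; apply is_pseries_const. Qed.

Lemma analytic_scal (c : R) u : analytic u -> analytic (fun x => c * u x).
Proof. intros Hu. apply analytic_mult; auto. apply analytic_const. Qed.

Lemma analytic_opp u : analytic u -> analytic (fun x => - u x).
Proof.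
  intros Hu. apply analytic_ext with (fun x => (-1) * u x).
  - intros x; ring.
  - apply analytic_scal; auto.
Qed.

Lemma analytic_minus u v : analytic u -> analytic v -> analytic (fun x => u x - v x).
Proof. intros Hu Hv. apply analytic_plus; auto. apply analytic_opp; auto. Qed.

Lemma PSeries_shift (a : nat -> R) C r x :
  geom_bounded a C r -> 0 < r -> r * Rabs x < / 2 ->
  PSeries a x = a O + x * PSeries (fun n => a (S n)) x.
Proof.
  intros Ha Hr Hx. apply PSeries_decr_1.
  exists (PSeries a x). apply geom_bounded_is_pseries with C r; auto.
Qed.

Lemma geom_bounded_shift a C r :
  geom_bounded a C r -> geom_bounded (fun n => a (S n)) (C * r) r.
Proof.
  intros Ha n. apply Rle_trans with (1 := Ha (S n)). simpl. right; ring.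
Qed.

Lemma analytic_factor_id (u : R -> R) :
  analytic u -> u 0 = 0 ->
  exists v, analytic v /\ locally 0 (fun x => u x = x * v x) /\ is_derive u 0 (v 0).
Proof.
  intros Hu Hu0. destruct (analytic_geom_PSeries u Hu) as [a [C [r [Ha [Hr H]]]]].
  set (v := PSeries (fun n => a (S n))).
  assert (Hv : analytic v).
  { apply analytic_PSeries with (fun n => a (S n)) (C * r) r.
    - apply geom_bounded_shift; auto.
    - lra.
    - apply filter_forall. reflexivity. }
  assert (Ha0 : a O = 0).
  { rewrite <- Hu0, H, PSeries_0; auto. rewrite Rabs_R0; lra. }
  assert (Huv : locally 0 (fun x => u x = x * v x)).
  { generalize (locally_0_geom r ltac:(lra)). apply filter_imp.
    intros x Hx. rewrite H by auto. rewrite (PSeries_shift a C r) by (auto; lra).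
    rewrite Ha0. fold v. ring. }
  exists v. split; [auto|split; auto].
  apply is_derive_ext_loc with (fun x => x * v x).
  - revert Huv. apply filter_imp. intros x Hx. auto.
  - destruct (analytic_is_derive v Hv) as [l Hl].
    auto_derive; [exists l; auto|ring].
Qed.

Lemma analytic_id : analytic (fun x => x).
Proof.
  exists (PS_incr_1 (PS_const 1)), 1. split; [lra|]. intros x _.
  evar_last.
  - apply is_pseries_incr_1, is_pseries_const.
  - unfold scal; simpl; unfold mult; simpl. ring.
Qed.

Lemma analytic_antidiagonals (u : nat -> nat -> R) (C r : R) (f : R -> R) :
  (forall j k, Rabs (u j k) <= C * r ^ (j + k)) -> 0 < r ->
  locally 0 (fun x => f x = Series (fun k => x ^ k * PSeries (fun j => u j k) x)) ->
  analytic f /\ f 0 = u O O /\ is_derive f 0 (u 1%nat O + u O 1%nat).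
Proof.
  intros Hu Hr Hf.
  set (a := fun n => sum_n (fun k => u (n - k)%nat k) n).
  assert (Ha : geom_bounded a (2 * C) (2 * r)).
  { apply geom_bounded_antidiagonals; auto; lra. }
  assert (Hfa : locally 0 (fun x => f x = PSeries a x)).
  { generalize (filter_and _ _ Hf (locally_0_geom (2 * r) ltac:(lra))).
    apply filter_imp. intros x [H1 H2].
    rewrite H1. apply PSeries_antidiagonals with C r; auto; lra. }
  split; [|split].
  - apply analytic_PSeries with a (2 * C) (2 * r); auto; lra.
  - rewrite (locally_singleton _ _ Hfa), PSeries_0. unfold a. rewrite sum_O. reflexivity.
  - apply is_derive_ext_loc with (PSeries a).
    + revert Hfa. apply filter_imp. auto.
    + evar_last.
      * apply is_derive_PSeries, geom_bounded_CV_radius with (2 * C) (2 * r); auto.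
        lra. rewrite Rabs_R0; lra.
      * rewrite PSeries_0. unfold PS_derive, a.
        rewrite sum_Sn, sum_O. unfold plus; simpl. ring.
Qed.

Fixpoint PS_pow (b : nat -> R) (k : nat) : nat -> R :=
  match k with
  | O => PS_const 1
  | S k => PS_mult b (PS_pow b k)
  end.

(** The Cauchy product of two bounds of the same ratio [r] would bring in a
    polynomial factor; doubling the ratio absorbs it, so that the bound on the
    powers is geometric in the exponent as well. *)
Lemma geom_bounded_PS_pow (b : nat -> R) C r k :
  geom_bounded b C r -> 0 <= r ->
  geom_bounded (PS_pow b k) ((2 * C) ^ k) (2 * r).
Proof.
  intros Hb Hr. pose proof (geom_bounded_nonneg _ _ _ Hb) as HC.
  induction k as [|k IH]; intros n.
  - destruct n as [|n]; simpl.
    + rewrite Rabs_R1; lra.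
    + rewrite Rabs_R0, Rmult_1_l.
      apply Rmult_le_pos; [lra|apply pow_le; lra].
  - simpl. unfold PS_mult. rewrite <- sum_n_Reals.
    apply Rle_trans with
      (sum_n (fun i => (C * (2 * C) ^ k * (2 * r) ^ n) * (/ 2) ^ i) n).
    + rewrite sum_n_Reals. apply Rle_trans with (1 := sum_f_R0_triangle _ _).
      rewrite sum_n_Reals. apply sum_Rle. intros i Hi.
      rewrite Rabs_mult.
      apply Rle_trans with ((C * r ^ i) * ((2 * C) ^ k * (2 * r) ^ (n - i))).
      * apply Rmult_le_compat; auto using Rabs_pos.
      * right. replace n with (i + (n - i))%nat at 2 by lia.
        rewrite (pow_add (2 * r) i), (Rpow_mult_distr 2 r i), pow_inv.
        field. apply pow_nonzero; lra.
    + rewrite (sum_n_mult_l (K := R_Ring)). unfold mult; simpl.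
      rewrite sum_n_Reals, tech3 by lra.
      assert (0 <= (/ 2) ^ S n) by (apply pow_le; lra).
      assert (0 <= C * (2 * C) ^ k * (2 * r) ^ n).
      { repeat apply Rmult_le_pos; auto; apply pow_le; lra. }
      apply Rle_trans with (C * (2 * C) ^ k * (2 * r) ^ n * 2); [|right; ring].
      apply Rmult_le_compat_l; auto. simpl in *. lra.
Qed.


Lemma PSeries_PS_pow (b : nat -> R) C r k x :
  geom_bounded b C r -> 0 < r -> 2 * r * Rabs x < / 2 ->
  PSeries (PS_pow b k) x = PSeries b x ^ k.
Proof.
  intros Hb Hr Hx. assert (0 <= Rabs x) by apply Rabs_pos.
  induction k as [|k IH]; simpl.
  - apply is_pseries_unique, is_pseries_const.
  - rewrite PSeries_mult, IH; auto.
    + apply geom_bounded_CV_radius with C r; auto. nra.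
    + apply geom_bounded_CV_radius with ((2 * C) ^ k) (2 * r); auto; try lra.
      apply geom_bounded_PS_pow; auto; lra.
Qed.

(** With [u(x) = x v(x)], the composite is the sum of the [g_k x^k v(x)^k].  The
    powers of [v] have coefficients bounded geometrically both in [k] and in
    their index, so this is a double power series summed by columns. *)
Lemma analytic_comp (g u : R -> R) :
  analytic g -> analytic u -> u 0 = 0 -> analytic (fun x => g (u x)).
Proof.
  intros Hg Hu Hu0.
  destruct (analytic_geom_PSeries g Hg) as [a [C [r [Ha [Hr Hga]]]]].
  destruct (analytic_factor_id u Hu Hu0) as [v [Hv [Huv _]]].
  destruct (analytic_geom_PSeries v Hv) as [b [C' [r' [Hb [Hr' Hvb]]]]].
  pose proof (geom_bounded_nonneg _ _ _ Ha) as HC.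
  pose proof (geom_bounded_nonneg _ _ _ Hb) as HC'.
  set (rho := r * (2 * C') + 2 * r').
  assert (Hrho : 0 <= r * (2 * C')) by (apply Rmult_le_pos; lra).
  apply (analytic_antidiagonals (fun j k => a k * PS_pow b k j) C rho).
  - intros j k. rewrite Rabs_mult, pow_add.
    apply Rle_trans with ((C * r ^ k) * ((2 * C') ^ k * (2 * r') ^ j)).
    + apply Rmult_le_compat; auto using Rabs_pos.
      apply geom_bounded_PS_pow; auto; lra.
    + replace (C * r ^ k * ((2 * C') ^ k * (2 * r') ^ j))
        with (C * ((2 * r') ^ j * (r * (2 * C')) ^ k))
        by (rewrite (Rpow_mult_distr r); ring).
      apply Rmult_le_compat_l; auto.
      apply Rmult_le_compat; try (apply pow_le; lra);
        apply pow_incr; unfold rho; lra.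
  - unfold rho; lra.
  - assert (Hsmall : locally 0 (fun x => r * Rabs (u x) < / 2)).
    { assert (Hc := analytic_continuous u Hu).
      apply (Hc (fun y => r * Rabs y < / 2)). rewrite Hu0. apply locally_0_geom; lra. }
    generalize (filter_and _ _ (filter_and _ _ Huv Hsmall)
                  (locally_0_geom (2 * r') ltac:(lra))).
    apply filter_imp. intros x [[H1 H2] H3].
    rewrite Hga by auto. unfold PSeries at 1. apply Series_ext. intros k.
    rewrite H1, Rpow_mult_distr, (Hvb x) by (pose proof (Rabs_pos x); nra).
    rewrite <- (PSeries_PS_pow b C' r') by (auto; lra).
    unfold PSeries. rewrite <- Rmult_assoc, <- (Series_scal_l (a k * x ^ k)), <- Series_scal_l.
    apply Series_ext. intros j. ring.
Qed.

(** * Elementary functions *)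

Lemma alternating_geom_bounded : geom_bounded (fun n => (-1) ^ n) 1 1.
Proof. intros n. rewrite pow_1_abs, pow1. lra. Qed.

Lemma PSeries_inv_1p (x : R) :
  Rabs x < 1 -> PSeries (fun n => (-1) ^ n) x = / (1 + x).
Proof.
  intros Hx. apply is_series_unique.
  apply is_series_ext with (fun n => (- x) ^ n).
  - intros n. rewrite <- Rpow_mult_distr. f_equal. ring.
  - replace (1 + x) with (1 - - x) by ring. apply is_series_geom.
    rewrite Rabs_Ropp; auto.
Qed.

Lemma analytic_inv_1p : analytic (fun x => / (1 + x)).
Proof.
  apply analytic_PSeries with (fun n => (-1) ^ n) 1 1.
  - apply alternating_geom_bounded.
  - lra.
  - apply locally_0_abs. exists 1. split; [lra|]. intros x Hx.
    symmetry; apply PSeries_inv_1p; auto.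
Qed.

Lemma analytic_Rinv u : analytic u -> u 0 <> 0 -> analytic (fun x => / u x).
Proof.
  intros Hu Hu0.
  apply analytic_ext with (fun x => / u 0 * / (1 + (/ u 0 * u x - 1))).
  - intros x. rewrite <- Rinv_mult. f_equal. field. auto.
  - apply analytic_scal.
    apply (analytic_comp (fun y => / (1 + y)) (fun x => / u 0 * u x - 1)).
    + apply analytic_inv_1p.
    + apply analytic_minus; [apply analytic_scal; auto|apply analytic_const].
    + field; auto.
Qed.

Lemma analytic_div u v :
  analytic u -> analytic v -> v 0 <> 0 -> analytic (fun x => u x / v x).
Proof. intros. apply analytic_mult; auto. apply analytic_Rinv; auto. Qed.

Lemma ln_1p_PSeries (x : R) :
  Rabs x < / 2 -> ln (1 + x) = PSeries (PS_Int (fun n => (-1) ^ n)) x.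
Proof.
  intros Hx.
  assert (H2 : is_RInt (fun t => / (1 + t)) 0 x (minus (ln (1 + x)) (ln (1 + 0)))).
  { apply (is_RInt_derive (fun t => ln (1 + t)) (fun t => / (1 + t))).
    - intros t Ht. assert (0 < 1 + t).
      { apply Rabs_def2 in Hx. unfold Rmin in Ht. destruct (Rle_dec 0 x); lra. }
      auto_derive; [lra|]. field. lra.
    - intros t Ht. assert (0 < 1 + t).
      { apply Rabs_def2 in Hx. unfold Rmin in Ht. destruct (Rle_dec 0 x); lra. }
      apply (ex_derive_continuous (fun t => / (1 + t))). auto_derive. lra. }
  apply (is_RInt_ext _ (PSeries (fun n => (-1) ^ n))) in H2.
  - assert (E2 : RInt (PSeries (fun n => (-1) ^ n)) 0 x = ln (1 + x) - ln (1 + 0))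
      by exact (is_RInt_unique _ _ _ _ H2).
    rewrite RInt_PSeries, Rplus_0_r, ln_1 in E2; [lra|].
    apply geom_bounded_CV_radius with 1 1; try lra. apply alternating_geom_bounded.
  - intros t Ht. symmetry. apply PSeries_inv_1p.
    apply Rabs_def2 in Hx. apply Rabs_def1;
    unfold Rmin, Rmax in Ht; destruct (Rle_dec 0 x); lra.
Qed.

Lemma geom_bounded_ln : geom_bounded (PS_Int (fun n => (-1) ^ n)) 1 1.
Proof.
  intros [|n]; unfold PS_Int; rewrite pow1.
  - rewrite Rabs_R0; lra.
  - unfold Rdiv. rewrite Rabs_mult, pow_1_abs, Rmult_1_l, Rmult_1_r.
    assert (1 <= INR (S n)).
    { rewrite S_INR. pose proof (pos_INR n). lra. }
    rewrite Rabs_pos_eq by (left; apply Rinv_0_lt_compat; lra).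
    rewrite <- Rinv_1. apply Rinv_le_contravar; lra.
Qed.

Lemma analytic_ln u : analytic u -> u 0 = 1 -> analytic (fun x => ln (u x)).
Proof.
  intros Hu Hu0. apply analytic_ext with (fun x => ln (1 + (u x - 1))).
  - intros x. f_equal. ring.
  - apply (analytic_comp (fun y => ln (1 + y)) (fun x => u x - 1)).
    + apply analytic_PSeries with (PS_Int (fun n => (-1) ^ n)) 1 1.
      * apply geom_bounded_ln.
      * lra.
      * apply locally_0_abs. exists (/ 2). split; [lra|]. apply ln_1p_PSeries.
    + apply analytic_minus; auto. apply analytic_const.
    + lra.
Qed.

(** This is artanh (sqrt x) / sqrt x for [0 < x < 1], and
    atan (sqrt (- x)) / sqrt (- x) for [-1 < x < 0]. *)
Definition artanh_sqrt (x : R) : R := PSeries (fun n => / INR (2 * n + 1)) x.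

Lemma geom_bounded_artanh_sqrt : geom_bounded (fun n => / INR (2 * n + 1)) 1 1.
Proof.
  intros n. rewrite pow1.
  assert (1 <= INR (2 * n + 1)).
  { rewrite plus_INR. pose proof (pos_INR (2 * n)). simpl (INR 1). lra. }
  rewrite Rabs_pos_eq by (left; apply Rinv_0_lt_compat; lra).
  rewrite Rmult_1_r, <- Rinv_1. apply Rinv_le_contravar; lra.
Qed.

Lemma analytic_artanh_sqrt : analytic artanh_sqrt.
Proof.
  apply analytic_PSeries with (fun n => / INR (2 * n + 1)) 1 1.
  - apply geom_bounded_artanh_sqrt.
  - lra.
  - apply filter_forall; reflexivity.
Qed.

Lemma artanh_sqrt_0 : artanh_sqrt 0 = 1.
Proof. unfold artanh_sqrt. rewrite PSeries_0. simpl. field. Qed.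

(** The even coefficients of [ln (1 + s)] cancel in the difference, and the odd
    ones are those of [artanh_sqrt]. *)
Lemma artanh_sqrt_real (s : R) :
  Rabs s < / 2 -> ln (1 + s) - ln (1 - s) = 2 * s * artanh_sqrt (s ^ 2).
Proof.
  intros Hs.
  assert (Hs2 : 1 * Rabs (s ^ 2) < / 2).
  { rewrite <- RPow_abs. pose proof (Rabs_pos s). nra. }
  set (l := PS_Int (fun n => (-1) ^ n)).
  assert (He : forall x, x ^ 2 = s ^ 2 -> PSeries l x =
    PSeries (fun n => l (2 * n)%nat) (s ^ 2) + x * artanh_sqrt (s ^ 2)).
  { intros x Hx. rewrite PSeries_odd_even, Hx.
    - f_equal. f_equal. apply PSeries_ext. intros n. unfold l.
      replace (2 * n + 1)%nat with (S (2 * n))%nat by lia.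
      unfold PS_Int. rewrite pow_1_even. field. apply not_0_INR; lia.
    - rewrite Hx. eexists. apply (geom_bounded_is_pseries _ 1 1); try lra.
      intros n. rewrite pow1. pose proof (geom_bounded_ln (2 * n)%nat) as H.
      rewrite pow1 in H. exact H.
    - rewrite Hx. eexists. apply (geom_bounded_is_pseries _ 1 1); try lra.
      intros n. rewrite pow1. pose proof (geom_bounded_ln (2 * n + 1)%nat) as H.
      rewrite pow1 in H. exact H. }
  rewrite (ln_1p_PSeries s) by auto.
  unfold Rminus at 2. rewrite (ln_1p_PSeries (- s)) by (rewrite Rabs_Ropp; auto).
  fold l. rewrite (He s), (He (- s)) by ring. ring.
Qed.

Lemma artanh_sqrt_imag (y : R) :
  Rabs y < 1 -> atan y = y * artanh_sqrt (- y ^ 2).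
Proof.
  intros Hy. rewrite atan_Reals by auto. f_equal.
  unfold artanh_sqrt, PSeries. apply Series_ext. intros n.
  replace (- y ^ 2) with ((-1) * y ^ 2) by ring.
  rewrite (Rpow_mult_distr (-1)).
  replace (S (n + n)) with (2 * n + 1)%nat by lia.
  field. apply not_0_INR; lia.
Qed.

(** * The principal logarithm *)

Lemma Clog_right_half_plane (x y : R) :
  0 < x -> Clog (x, y) = (ln (x ^ 2 + y ^ 2) / 2, atan (y / x)).
Proof.
  intros Hx. unfold Clog.
  assert (Hn : 0 < x ^ 2 + y ^ 2) by nra.
  set (m := Cmod (x, y)).
  assert (Hm : 0 < m) by (apply sqrt_lt_R0; simpl in *; lra).
  assert (Hm2 : m * m = x ^ 2 + y ^ 2) by (apply sqrt_sqrt; simpl in *; lra).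
  f_equal.
  - rewrite <- Hm2, ln_mult by auto. field.
  - assert (Hacos : acos (x / m) = atan (Rabs y / x)).
    { rewrite acos_atan by (apply Rdiv_lt_0_compat; auto).
      f_equal.
      replace (1 - (x / m)²) with ((Rabs y / m)²).
      - rewrite sqrt_Rsqr; [field; lra|].
        apply Rmult_le_pos; [apply Rabs_pos|left; apply Rinv_0_lt_compat; auto].
      - unfold Rsqr.
        replace (Rabs y / m * (Rabs y / m)) with ((Rabs y * Rabs y) / (m * m))
          by (field; lra).
        replace (Rabs y * Rabs y) with (y * y)
          by (rewrite <- Rabs_mult, Rabs_pos_eq; nra).
        replace (y * y) with (m * m - x * x) by lra. field. lra. }
    unfold Carg. fold m. simpl. rewrite Hacos.
    destruct (Rle_dec 0 y) as [Hy|Hy].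
    + rewrite Rabs_pos_eq by auto. reflexivity.
    + rewrite Rabs_left by lra. rewrite <- atan_opp. f_equal. field. lra.
Qed.

Lemma Rabs_lt_of_sq (x c : R) : 0 < c -> x ^ 2 < c ^ 2 -> Rabs x < c.
Proof. intros Hc H. apply Rabs_def1; nra. Qed.

(** The square roots of a real number, together with the fact that they lie on
    one of the two axes, where the logarithm is given by real functions. *)
Definition on_axis_sqrt (eta : R) (s : C) : Prop :=
  (exists x, s = RtoC x /\ x ^ 2 = eta) \/ (exists y, s = (0, y) /\ - y ^ 2 = eta).

(** The even and odd parts in [s] of the logarithm are given by the same real
    functions of [eta = s^2] on the two axes.  With [T = B / A], the odd part is
    artanh (x T) for [s = x] real, and [i] times the argument atan (y T) for
    [s = i y]. *)
Lemma Clog_even_odd (A B eta : R) (s : C) :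
  on_axis_sqrt eta s -> 0 < A -> Rabs eta * (B / A) ^ 2 < / 4 ->
  Clog (RtoC A + s * RtoC B)%C =
  (RtoC (ln (A ^ 2 - eta * B ^ 2) / 2)
   + s * RtoC (B / A * artanh_sqrt (eta * (B / A) ^ 2)))%C.
Proof.
  intros Hs HA Hsmall.
  set (T := B / A) in *.
  assert (HB : B = A * T) by (unfold T; field; lra).
  destruct Hs as [[x [-> Hx]]|[y [-> Hy]]].
  - assert (HxT : Rabs (x * T) < / 2).
    { rewrite <- Hx, <- RPow_abs, pow2_abs in Hsmall.
      apply Rabs_lt_of_sq; lra. }
    apply Rabs_def2 in HxT as HxT'.
    rewrite <- RtoC_mult, <- RtoC_plus.
    unfold RtoC at 1. rewrite Clog_right_half_plane by (rewrite HB; nra).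
    unfold Rdiv at 2. rewrite Rmult_0_l, atan_0.
    rewrite <- RtoC_mult, <- RtoC_plus. unfold RtoC. f_equal.
    assert (H1 : 0 < 1 + x * T) by lra.
    assert (H2 : 0 < 1 - x * T) by lra.
    replace ((A + x * B) ^ 2 + 0 ^ 2) with (A * A * ((1 + x * T) * (1 + x * T)))
      by (rewrite HB; ring).
    replace (A ^ 2 - eta * B ^ 2) with (A * A * ((1 + x * T) * (1 - x * T)))
      by (rewrite HB, <- Hx; ring).
    rewrite !ln_mult by (repeat apply Rmult_lt_0_compat; auto).
    assert (H := artanh_sqrt_real (x * T) HxT).
    replace ((x * T) ^ 2) with (eta * T ^ 2) in H by (rewrite <- Hx; ring).
    lra.
  - assert (HyT : Rabs (y * T) < 1).
    { rewrite <- Hy, Rabs_Ropp, <- RPow_abs, pow2_abs in Hsmall.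
      apply Rabs_lt_of_sq; lra. }
    replace (RtoC A + (0, y) * RtoC B)%C with (A, y * B).
    2:{ unfold RtoC, Cplus, Cmult; simpl. f_equal; ring. }
    rewrite Clog_right_half_plane by auto.
    replace (y * B / A) with (y * T) by (unfold T; field; lra).
    rewrite artanh_sqrt_imag by auto.
    unfold RtoC, Cplus, Cmult; simpl. f_equal.
    + replace (A * (A * 1) - eta * (B * (B * 1))) with (A * (A * 1) + y * B * (y * B * 1)) by (rewrite <- Hy; ring).
      ring.
    + replace (- (y * T * (y * T * 1))) with (eta * (T * (T * 1))) by (rewrite <- Hy; ring).
      ring.
Qed.

Open Scope C_scope.

(** * Complex series *)

(** Defined by components, so that the sums of real series apply. *)
Definition CSeries (a : nat -> C) : C :=
  (Series (fun n => Re (a n)), Series (fun n => Im (a n))).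

Definition Cgeom (a : nat -> C) (M q : R) : Prop :=
  forall n, (Cmod (a n) <= M * q ^ n)%R.

Lemma im_le_Cmod (z : C) : (Rabs (Im z) <= Cmod z)%R.
Proof. apply Rle_trans with (2 := Rmax_Cmod z), Rmax_r. Qed.

Lemma Cmod_le_re_im (z : C) : (Cmod z <= Rabs (Re z) + Rabs (Im z))%R.
Proof.
  replace z with (RtoC (Re z) + Ci * RtoC (Im z))%C at 1.
  - apply Rle_trans with (1 := Cmod_triangle _ _).
    rewrite Cmod_mult, !Cmod_R, Cmod_Ci. lra.
  - destruct z. unfold RtoC, Ci, Cplus, Cmult; simpl. f_equal; ring.
Qed.

Lemma Cgeom_Re a M q : Cgeom a M q -> forall n, (Rabs (Re (a n)) <= M * q ^ n)%R.
Proof. intros H n. apply Rle_trans with (1 := re_le_Cmod _), H. Qed.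

Lemma Cgeom_Im a M q : Cgeom a M q -> forall n, (Rabs (Im (a n)) <= M * q ^ n)%R.
Proof. intros H n. apply Rle_trans with (1 := im_le_Cmod _), H. Qed.

Lemma Cgeom_nonneg a M q : Cgeom a M q -> (0 <= M)%R.
Proof. intros H. specialize (H O). pose proof (Cmod_ge_0 (a O)). simpl in H. lra. Qed.

Lemma CSeries_ext a b : (forall n, a n = b n) -> CSeries a = CSeries b.
Proof. intros H. unfold CSeries. f_equal; apply Series_ext; intros n; rewrite H; auto. Qed.

Lemma CSeries_plus a b M M' q :
  (0 <= q <= / 2)%R -> Cgeom a M q -> Cgeom b M' q ->
  CSeries (fun n => a n + b n) = CSeries a + CSeries b.
Proof.
  intros Hq Ha Hb. unfold CSeries, Cplus; simpl.
  f_equal; apply Series_plus; eapply ex_series_geom_dominated;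
    eauto using Cgeom_Re, Cgeom_Im; lra.
Qed.

Lemma CSeries_scal (c : C) a M q :
  (0 <= q <= / 2)%R -> Cgeom a M q ->
  CSeries (fun n => c * a n) = c * CSeries a.
Proof.
  intros Hq Ha. unfold CSeries, Cmult; simpl.
  assert (H1 : ex_series (fun n => Re (a n)))
    by (apply (ex_series_geom_dominated _ M q); eauto using Cgeom_Re; lra).
  assert (H2 : ex_series (fun n => Im (a n)))
    by (apply (ex_series_geom_dominated _ M q); eauto using Cgeom_Im; lra).
  assert (Hsc : forall (x : R) (b : nat -> R),
    ex_series b -> ex_series (fun n => x * b n)%R).
  { intros x b. apply (ex_series_scal_l (K := R_AbsRing) (V := R_NormedModule) x b). }
  f_equal; rewrite <- !Series_scal_l.
  - rewrite <- Series_minus; auto.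
  - rewrite <- Series_plus; auto.
Qed.

Lemma CSeries_shift a M q :
  (0 <= q <= / 2)%R -> Cgeom a M q ->
  CSeries a = a O + CSeries (fun n => a (S n)).
Proof.
  intros Hq Ha. unfold CSeries, Cplus; simpl.
  f_equal; apply Series_incr_1; eapply ex_series_geom_dominated;
    eauto using Cgeom_Re, Cgeom_Im; lra.
Qed.

Lemma Cmod_CSeries_le a M q :
  (0 <= q <= / 2)%R -> Cgeom a M q -> (Cmod (CSeries a) <= 4 * M)%R.
Proof.
  intros Hq Ha. apply Rle_trans with (1 := Cmod_le_re_im _). simpl.
  pose proof (Series_geom_dominated _ M q Hq (Cgeom_Re _ _ _ Ha)).
  pose proof (Series_geom_dominated _ M q Hq (Cgeom_Im _ _ _ Ha)).
  lra.
Qed.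

Lemma Series_even_odd (a : nat -> R) (M q : R) :
  (0 <= q <= / 2)%R -> (forall n, (Rabs (a n) <= M * q ^ n)%R) ->
  Series a = (Series (fun n => a (2 * n)%nat) + Series (fun n => a (2 * n + 1)%nat))%R.
Proof.
  intros Hq Ha.
  assert (HM : (0 <= M)%R).
  { specialize (Ha O). pose proof (Rabs_pos (a O)). simpl in Ha. lra. }
  assert (Hex : forall i, ex_series (fun n => a (2 * n + i)%nat)).
  { intros i. apply (ex_series_geom_dominated _ M q); [lra|].
    intros n. apply Rle_trans with (1 := Ha _).
    apply Rmult_le_compat_l; auto.
    replace (2 * n + i)%nat with (n + (n + i))%nat by lia. rewrite pow_add.
    rewrite <- (Rmult_1_r (q ^ n)) at 2. apply Rmult_le_compat_l; [apply pow_le; lra|].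
    rewrite <- (pow1 (n + i)). apply pow_incr; lra. }
  assert (Hp : forall b : nat -> R, ex_series b -> ex_pseries b (1 ^ 2)%R).
  { intros b. apply ex_series_ext. intros n.
    replace (1 ^ 2)%R with 1%R by ring. rewrite pow_n_pow, pow1.
    unfold scal; simpl; unfold mult; simpl. ring. }
  rewrite <- !PSeries_1, PSeries_odd_even.
  - replace (1 ^ 2)%R with 1%R by ring. ring.
  - apply Hp. apply ex_series_ext with (2 := Hex O). intros n. f_equal. lia.
  - apply Hp, Hex.
Qed.

Lemma CSeries_even_odd a M q :
  (0 <= q <= / 2)%R -> Cgeom a M q ->
  CSeries a = CSeries (fun n => a (2 * n)%nat) + CSeries (fun n => a (2 * n + 1)%nat).
Proof.
  intros Hq Ha. unfold CSeries, Cplus. unfold fst, snd. f_equal.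
  - apply (Series_even_odd (fun n => Re (a n)) M q); auto using Cgeom_Re.
  - apply (Series_even_odd (fun n => Im (a n)) M q); auto using Cgeom_Im.
Qed.

(** * Power series in one complex variable *)

Definition CPSeries (d : nat -> C) (w : C) : C := CSeries (fun k => d k * w ^ k).

Definition CPS_derive (d : nat -> C) (k : nat) : C := RtoC (INR (S k)) * d (S k).

Lemma Cgeom_term d M r w :
  Cgeom d M r -> (0 <= r)%R -> Cgeom (fun k => d k * w ^ k) M (r * Cmod w).
Proof.
  intros Hd Hr k. rewrite Cmod_mult, Cmod_pow, Rpow_mult_distr, <- Rmult_assoc.
  apply Rmult_le_compat_r; auto. apply pow_le, Cmod_ge_0.
Qed.

Lemma Cgeom_CPS_derive d M r :
  Cgeom d M r -> (0 <= r)%R -> Cgeom (CPS_derive d) (2 * M * r) (2 * r).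
Proof.
  intros Hd Hr k. unfold CPS_derive.
  pose proof (Cgeom_nonneg _ _ _ Hd).
  rewrite Cmod_mult, Cmod_R, Rabs_pos_eq by apply pos_INR.
  apply Rle_trans with (2 ^ S k * (M * r ^ S k))%R.
  - apply Rmult_le_compat; auto using pos_INR, Cmod_ge_0, INR_le_pow2.
  - right. rewrite Rpow_mult_distr. simpl. ring.
Qed.

Lemma Cmod_CPSeries_le d M r w :
  Cgeom d M r -> (0 <= r)%R -> (r * Cmod w <= / 2)%R ->
  (Cmod (CPSeries d w) <= 4 * M)%R.
Proof.
  intros Hd Hr Hw. apply Cmod_CSeries_le with (r * Cmod w)%R.
  - split; auto. apply Rmult_le_pos; auto. apply Cmod_ge_0.
  - apply Cgeom_term; auto.
Qed.

Lemma CPSeries_shift d M r w :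
  Cgeom d M r -> (0 <= r)%R -> (r * Cmod w <= / 2)%R ->
  CPSeries d w = d O + w * CPSeries (fun k => d (S k)) w.
Proof.
  intros Hd Hr Hw.
  assert (Hq : (0 <= r * Cmod w <= / 2)%R).
  { split; auto. apply Rmult_le_pos; auto. apply Cmod_ge_0. }
  unfold CPSeries. rewrite (CSeries_shift _ M (r * Cmod w)); auto.
  - f_equal; [simpl; ring|].
    rewrite <- (CSeries_scal w _ (M * r) (r * Cmod w)); auto.
    + apply CSeries_ext. intros k. simpl. ring.
    + apply Cgeom_term; auto. intros k. apply Rle_trans with (1 := Hd (S k)).
      simpl. right; ring.
  - apply Cgeom_term; auto.
Qed.

Lemma CPSeries_near_0 d M r w :
  Cgeom d M r -> (0 <= r)%R -> (r * Cmod w <= / 2)%R ->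
  (Cmod (CPSeries d w - d O) <= 4 * (M * r) * Cmod w)%R.
Proof.
  intros Hd Hr Hw. rewrite (CPSeries_shift d M r w) by auto.
  replace (d O + w * CPSeries (fun k => d (S k)) w - d O)
    with (w * CPSeries (fun k => d (S k)) w) by ring.
  rewrite Cmod_mult, Rmult_comm. apply Rmult_le_compat_r; [apply Cmod_ge_0|].
  apply Cmod_CPSeries_le with r; auto.
  intros k. apply Rle_trans with (1 := Hd (S k)). simpl. right; ring.
Qed.

(** The second order Taylor remainder of [w^k]. *)
Definition pow_remainder (w w' : C) (k : nat) : C :=
  w' ^ k - w ^ k - (w' - w) * (RtoC (INR k) * w ^ pred k).

Lemma pow_remainder_S w w' k :
  pow_remainder w w' (S k) =
  w' * pow_remainder w w' k + (w' - w) ^ 2 * (RtoC (INR k) * w ^ pred k).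
Proof.
  unfold pow_remainder. rewrite S_INR, RtoC_plus. simpl pred.
  destruct k as [|k].
  - simpl. ring.
  - simpl pred. rewrite !Cpow_S. ring.
Qed.

(** The exact bound has a factor of order [k^2]; the ratio [2 rho] absorbs it and
    makes the induction immediate. *)
Lemma Cmod_pow_remainder_le w w' rho k :
  (0 < rho)%R -> (Cmod w <= rho)%R -> (Cmod w' <= rho)%R ->
  (Cmod (pow_remainder w w' k) <= Cmod (w' - w) ^ 2 / rho ^ 2 * (2 * rho) ^ k)%R.
Proof.
  intros Hr Hw Hw'.
  set (h := Cmod (w' - w)).
  assert (Hh : (0 <= h ^ 2)%R) by apply pow2_ge_0.
  assert (Hh' : (0 <= h ^ 2 / rho ^ 2)%R).
  { apply Rmult_le_pos; auto. left. apply Rinv_0_lt_compat, pow_lt; auto. }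
  induction k as [|k IH].
  - unfold pow_remainder. simpl.
    replace (1 - 1 - (w' - w) * (0 * 1)) with (RtoC 0) by ring.
    rewrite Cmod_0. simpl in Hh'. lra.
  - rewrite pow_remainder_S.
    apply Rle_trans with (1 := Cmod_triangle _ _).
    rewrite !Cmod_mult, !Cmod_pow, Cmod_R, Rabs_pos_eq by apply pos_INR. fold h.
    assert (Hpow : (INR k * Cmod w ^ pred k <= 2 ^ k * (rho ^ k / rho))%R).
    { destruct k as [|k].
      - simpl. rewrite Rmult_0_l, Rmult_1_l. unfold Rdiv. rewrite Rmult_1_l.
        left. apply Rinv_0_lt_compat; auto.
      - replace (rho ^ S k / rho)%R with (rho ^ k)%R by (simpl; field; lra).
        simpl pred. apply Rmult_le_compat; auto using pos_INR, INR_le_pow2.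
        apply pow_le, Cmod_ge_0. apply pow_incr; split; auto using Cmod_ge_0. }
    apply Rle_trans with
      (rho * (h ^ 2 / rho ^ 2 * (2 * rho) ^ k) + h ^ 2 * (2 ^ k * (rho ^ k / rho)))%R.
    + apply Rplus_le_compat.
      * apply Rmult_le_compat; auto using Cmod_ge_0.
      * apply Rmult_le_compat_l; auto.
    + right. rewrite !Rpow_mult_distr. simpl. field. lra.
Qed.

(** Termwise: on the disc of radius [rho = 1 / (4 r)] the remainders of the
    monomials are of size [(2 rho)^k], against [r^k] for the coefficients, so
    their sum converges like a geometric series of ratio 1/2. *)
Lemma CPSeries_taylor2 d M r w w' :
  Cgeom d M r -> (0 < r)%R -> (r * Cmod w <= / 4)%R -> (r * Cmod w' <= / 4)%R ->
  (Cmod (CPSeries d w' - CPSeries d w - CPSeries (CPS_derive d) w * (w' - w))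
   <= 64 * M * r ^ 2 * Cmod (w' - w) ^ 2)%R.
Proof.
  intros Hd Hr Hw Hw'. pose proof (Cgeom_nonneg _ _ _ Hd) as HM.
  assert (Hle : forall v, (r * Cmod v <= / 4)%R -> (Cmod v <= / (4 * r))%R).
  { intros v Hv. apply Rmult_le_reg_l with r; auto.
    replace (r * / (4 * r))%R with (/ 4)%R by (field; lra). auto. }
  assert (Hrho : (0 < / (4 * r))%R) by (apply Rinv_0_lt_compat; lra).
  set (h := w' - w).
  set (e := fun k => h * (d k * (RtoC (INR k) * w ^ pred k))).
  set (rem := fun k => d k * pow_remainder w w' k).
  assert (Hhalf : (0 <= / 2 <= / 2)%R) by lra.
  assert (Hrem : Cgeom rem (16 * M * r ^ 2 * Cmod h ^ 2) (/ 2)).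
  { intros k. unfold rem. rewrite Cmod_mult.
    apply Rle_trans with
      (M * r ^ k * (Cmod h ^ 2 / (/ (4 * r)) ^ 2 * (2 * / (4 * r)) ^ k))%R.
    - apply Rmult_le_compat; auto using Cmod_ge_0.
      apply Cmod_pow_remainder_le; auto.
    - right. replace (2 * / (4 * r))%R with (/ 2 * / r)%R by (field; lra).
      rewrite Rpow_mult_distr, pow_inv. replace ((/ r) ^ k)%R with (/ r ^ k)%R
        by (symmetry; apply pow_inv).
      field. split; [apply pow_nonzero|]; lra. }
  assert (Hmono : forall v, (r * Cmod v <= / 4)%R ->
    Cgeom (fun k => d k * v ^ k) M (/ 2)).
  { intros v Hv k. apply Rle_trans with (1 := Cgeom_term d M r v Hd ltac:(lra) k).
    apply Rmult_le_compat_l; auto. apply pow_incr.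
    split; [apply Rmult_le_pos; [lra|apply Cmod_ge_0]|lra]. }
  assert (Hterm : Cgeom (fun k => CPS_derive d k * w ^ k) (2 * M * r) (/ 2)).
  { intros k. apply Rle_trans with
      (1 := Cgeom_term _ _ _ w (Cgeom_CPS_derive d M r Hd ltac:(lra)) ltac:(lra) k).
    apply Rmult_le_compat_l; [apply Rmult_le_pos; lra|]. apply pow_incr.
    split; [|lra]. apply Rmult_le_pos; [lra|apply Cmod_ge_0]. }
  assert (He : Cgeom (fun k => d k * (RtoC (INR k) * w ^ pred k)) (4 * M * r) (/ 2)).
  { intros [|k].
    - simpl. rewrite Cmult_0_l, Cmult_0_r, Cmod_0. nra.
    - simpl pred. specialize (Hterm k). unfold CPS_derive in Hterm.
      replace (d (S k) * (RtoC (INR (S k)) * w ^ k))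
        with (RtoC (INR (S k)) * d (S k) * w ^ k) by ring.
      apply Rle_trans with (1 := Hterm). simpl. right. field. }
  assert (HD : CPSeries (CPS_derive d) w * h = CSeries e).
  { unfold e. rewrite (CSeries_scal h _ (4 * M * r) (/ 2)) by auto.
    rewrite (CSeries_shift _ (4 * M * r) (/ 2)) by auto.
    replace (d 0%nat * (RtoC (INR 0) * w ^ pred 0)) with (RtoC 0) by (simpl; ring).
    rewrite Cplus_0_l, Cmult_comm. f_equal. apply CSeries_ext. intros k.
    unfold CPS_derive. simpl pred. ring. }
  assert (Hsum : CPSeries d w' = CPSeries d w + (CSeries e + CSeries rem)).
  { assert (He' : Cgeom e (Cmod h * (4 * M * r)) (/ 2)).
    { intros k. unfold e. rewrite Cmod_mult, Rmult_assoc.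
      apply Rmult_le_compat_l; auto using Cmod_ge_0. }
    rewrite <- (CSeries_plus e rem _ _ (/ 2) Hhalf He' Hrem).
    unfold CPSeries.
    rewrite <- (CSeries_plus _ _ M (Cmod h * (4 * M * r) + 16 * M * r ^ 2 * Cmod h ^ 2) (/ 2)); auto.
    - apply CSeries_ext. intros k. unfold e, rem, pow_remainder, h. ring.
    - intros k. apply Rle_trans with (1 := Cmod_triangle _ _).
      rewrite Rmult_plus_distr_r. apply Rplus_le_compat; auto. }
  rewrite Hsum, HD.
  replace (CPSeries d w + (CSeries e + CSeries rem) - CPSeries d w - CSeries e)
    with (CSeries rem) by ring.
  apply Rle_trans with (1 := Cmod_CSeries_le rem _ _ Hhalf Hrem).
  right. ring.
Qed.

Lemma CPSeries_even_odd d M r s x :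
  Cgeom d M r -> (0 <= r)%R -> (r * Cmod s <= / 2)%R -> s ^ 2 = x ->
  CPSeries d s =
  CPSeries (fun k => d (2 * k)%nat) x + s * CPSeries (fun k => d (2 * k + 1)%nat) x.
Proof.
  intros Hd Hr Hs Hx.
  assert (Hq : (0 <= r * Cmod s <= / 2)%R).
  { split; auto. apply Rmult_le_pos; auto. apply Cmod_ge_0. }
  assert (Hq' : (0 <= r ^ 2 * Cmod x <= / 2)%R).
  { rewrite <- Hx, Cmod_pow, <- Rpow_mult_distr. nra. }
  unfold CPSeries at 1.
  rewrite (CSeries_even_odd _ M (r * Cmod s)); auto using Cgeom_term.
  unfold CPSeries. f_equal.
  - apply CSeries_ext. intros k. rewrite Cpow_mult_r, Hx. auto.
  - rewrite <- (CSeries_scal s _ (M * r) (r ^ 2 * Cmod x)); auto.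
    + apply CSeries_ext. intros k. rewrite Cpow_add_r, Cpow_mult_r, Hx, Cpow_1_r. ring.
    + apply Cgeom_term; [|apply pow2_ge_0]. intros k.
      apply Rle_trans with (1 := Hd _). right.
      rewrite pow_add, pow_mult. ring.
Qed.

(** * Complex differentiability with a quadratic remainder *)

(** Stronger than differentiability, but free of filters, and as easy for power
    series; unlike [is_derive] it transfers directly through complex
    conjugation. *)
Definition taylor2 (f : C -> C) (z l : C) : Prop :=
  exists K d : R, (0 < d)%R /\ (0 <= K)%R /\ forall z', (Cmod (z' - z) < d)%R ->
    (Cmod (f z' - f z - l * (z' - z)) <= K * Cmod (z' - z) ^ 2)%R.

Lemma taylor2_is_derive f z l :
  taylor2 f z l -> is_derive (K := C_AbsRing) (V := C_NormedModule) f z l.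
Proof.
  intros [K [d [Hd [HK H]]]]. split; [apply is_linear_scal_l|].
  intros x Hx. apply (is_filter_lim_locally_unique (K := C_AbsRing)
    (V := AbsRing_NormedModule C_AbsRing)) in Hx.
  subst x. intros eps.
  assert (He : (0 < Rmin d (eps / (K + 1)))%R).
  { apply Rmin_glb_lt; auto. apply Rdiv_lt_0_compat; [apply cond_pos|lra]. }
  exists (mkposreal _ He). intros y Hy.
  change (Cmod (y - z) < Rmin d (eps / (K + 1)))%R in Hy.
  change (Cmod (f y - f z - (y - z) * l) <= eps * Cmod (y - z))%R.
  rewrite (Cmult_comm (y - z) l).
  apply Rle_trans with (1 := H y (Rlt_le_trans _ _ _ Hy (Rmin_l _ _))).
  assert (Hy2 : (Cmod (y - z) <= eps / (K + 1))%R).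
  { left. apply Rlt_le_trans with (1 := Hy), Rmin_r. }
  pose proof (Cmod_ge_0 (y - z)) as Hp.
  replace (K * Cmod (y - z) ^ 2)%R with (K * Cmod (y - z) * Cmod (y - z))%R by ring.
  apply Rmult_le_compat_r; auto.
  apply Rle_trans with ((K + 1) * (eps / (K + 1)))%R.
  - apply Rmult_le_compat; lra.
  - right. field. lra.
Qed.

Lemma taylor2_lipschitz f z l :
  taylor2 f z l -> exists L d : R, (0 < d)%R /\ (0 <= L)%R /\
    forall z', (Cmod (z' - z) < d)%R -> (Cmod (f z' - f z) <= L * Cmod (z' - z))%R.
Proof.
  intros [K [d [Hd [HK H]]]].
  exists (K + Cmod l)%R, (Rmin d 1). pose proof (Cmod_ge_0 l).
  split; [apply Rmin_glb_lt; lra|split; [lra|]].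
  intros z' Hz'.
  assert (H1 : (Cmod (z' - z) < d)%R) by (apply Rlt_le_trans with (1 := Hz'), Rmin_l).
  assert (H2 : (Cmod (z' - z) < 1)%R) by (apply Rlt_le_trans with (1 := Hz'), Rmin_r).
  specialize (H z' H1).
  replace (f z' - f z) with ((f z' - f z - l * (z' - z)) + l * (z' - z)) by ring.
  apply Rle_trans with (1 := Cmod_triangle _ _). rewrite Cmod_mult.
  pose proof (Cmod_ge_0 (z' - z)).
  rewrite Rmult_plus_distr_r. apply Rplus_le_compat_r.
  apply Rle_trans with (1 := H). apply Rmult_le_compat_l; auto. nra.
Qed.

Lemma taylor2_comp f g z l m :
  taylor2 f z l -> taylor2 g (f z) m -> taylor2 (fun x => g (f x)) z (m * l).
Proof.
  intros Hf [K' [d' [Hd' [HK' Hg]]]].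
  destruct (taylor2_lipschitz _ _ _ Hf) as [L [e [He [HL Hlip]]]].
  destruct Hf as [K [d [Hd [HK Hf]]]].
  pose proof (Cmod_ge_0 m).
  assert (Hq : (0 < d' / (L + 1))%R) by (apply Rdiv_lt_0_compat; lra).
  exists (K' * L ^ 2 + Cmod m * K)%R, (Rmin (Rmin d e) (d' / (L + 1))).
  split; [repeat apply Rmin_glb_lt; auto|].
  split.
  { apply Rplus_le_le_0_compat; apply Rmult_le_pos; auto. apply pow2_ge_0. }
  intros z' Hz'. pose proof (Cmod_ge_0 (z' - z)) as Hp.
  assert (H1 : (Cmod (z' - z) < d)%R).
  { apply Rlt_le_trans with (1 := Hz'), Rle_trans with (1 := Rmin_l _ _), Rmin_l. }
  assert (H2 : (Cmod (z' - z) < e)%R).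
  { apply Rlt_le_trans with (1 := Hz'), Rle_trans with (1 := Rmin_l _ _), Rmin_r. }
  assert (H3 : (Cmod (z' - z) < d' / (L + 1))%R).
  { apply Rlt_le_trans with (1 := Hz'), Rmin_r. }
  specialize (Hf z' H1). specialize (Hlip z' H2).
  assert (H4 : (Cmod (f z' - f z) < d')%R).
  { apply Rle_lt_trans with (1 := Hlip).
    apply Rle_lt_trans with ((L + 1) * Cmod (z' - z))%R; [nra|].
    apply Rmult_lt_reg_l with (/ (L + 1))%R; [apply Rinv_0_lt_compat; lra|].
    rewrite <- Rmult_assoc, Rinv_l, Rmult_1_l, Rmult_comm by lra. exact H3. }
  specialize (Hg (f z') H4).
  replace (g (f z') - g (f z) - m * l * (z' - z))
    with ((g (f z') - g (f z) - m * (f z' - f z)) + m * (f z' - f z - l * (z' - z)))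
    by ring.
  apply Rle_trans with (1 := Cmod_triangle _ _). rewrite Cmod_mult.
  rewrite Rmult_plus_distr_r. apply Rplus_le_compat.
  - apply Rle_trans with (1 := Hg). rewrite Rmult_assoc.
    apply Rmult_le_compat_l; auto.
    rewrite <- Rpow_mult_distr. apply pow_incr. split; auto using Cmod_ge_0.
  - rewrite Rmult_assoc. apply Rmult_le_compat_l; auto.
Qed.

Lemma taylor2_conj f z l :
  taylor2 f (Cconj z) l ->
  taylor2 (fun x => Cconj (f (Cconj x))) z (Cconj l).
Proof.
  intros [K [d [Hd [HK H]]]]. exists K, d. split; [auto|split; [auto|]].
  intros z' Hz'.
  rewrite <- (Cmod_conj (z' - z)), Cminus_conj in *.
  rewrite <- (Cmod_conj (_ - _ - _)), !Cminus_conj, Cmult_conj, Cminus_conj, !Cconj_conj.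
  auto.
Qed.

Lemma taylor2_ext_loc f g z l (e : R) :
  (0 < e)%R -> (forall z', (Cmod (z' - z) < e)%R -> f z' = g z') ->
  taylor2 f z l -> taylor2 g z l.
Proof.
  intros He Hfg [K [d [Hd [HK H]]]]. exists K, (Rmin d e).
  split; [apply Rmin_glb_lt; auto|split; auto].
  intros z' Hz'. rewrite <- (Hfg z), <- (Hfg z').
  - apply H. apply Rlt_le_trans with (1 := Hz'), Rmin_l.
  - apply Rlt_le_trans with (1 := Hz'), Rmin_r.
  - replace (z - z) with (RtoC 0) by ring. rewrite Cmod_0. auto.
Qed.

Lemma taylor2_unique f z l m : taylor2 f z l -> taylor2 f z m -> l = m.
Proof.
  intros H1 H2. apply taylor2_is_derive, is_C_derive_unique in H1.
  apply taylor2_is_derive, is_C_derive_unique in H2. congruence.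
Qed.

(** * Power series in one real and one complex variable *)

Definition double_bounded (c : nat -> nat -> C) (M r : R) : Prop :=
  forall j k, (Cmod (c j k) <= M * r ^ (j + k))%R.

Definition slice (c : nat -> nat -> C) (t : R) (k : nat) : C :=
  CPSeries (fun j => c j k) (RtoC t).

Lemma Cgeom_slice c M r t :
  double_bounded c M r -> (0 <= r)%R -> (r * Rabs t <= / 2)%R ->
  Cgeom (slice c t) (4 * M) r.
Proof.
  intros Hc Hr Ht k. rewrite Rmult_assoc. apply Cmod_CPSeries_le with r; auto.
  - intros j. apply Rle_trans with (1 := Hc j k). rewrite pow_add. right; ring.
  - rewrite Cmod_R. auto.
Qed.

Definition has_expansion (F : R -> C -> C) (c : nat -> nat -> C) (M r : R) : Prop :=
  (1 <= r)%R /\ double_bounded c M r /\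
  forall t w, (r * Rabs t <= / 4)%R -> (r * Cmod w <= / 4)%R ->
    F t w = CPSeries (slice c t) w.

Lemma filterlim_C_fst (u : nat -> C) (l : C) :
  filterlim u eventually (locally l) -> is_lim_seq (fun n => Re (u n)) (Re l).
Proof.
  intros H. apply (filterlim_comp _ _ _ u Re _ _ _ H).
  intros P [e He]. exists e. intros y [Hy _]. apply He, Hy.
Qed.

Lemma filterlim_C_snd (u : nat -> C) (l : C) :
  filterlim u eventually (locally l) -> is_lim_seq (fun n => Im (u n)) (Im l).
Proof.
  intros H. apply (filterlim_comp _ _ _ u Im _ _ _ H).
  intros P [e He]. exists e. intros y [_ Hy]. apply He, Hy.
Qed.

Lemma sum_n_Re (a : nat -> C) n : Re (sum_n a n) = sum_n (fun k => Re (a k)) n.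
Proof.
  induction n as [|n IH]; [rewrite !sum_O; auto|].
  rewrite !sum_Sn, <- IH. reflexivity.
Qed.

Lemma sum_n_Im (a : nat -> C) n : Im (sum_n a n) = sum_n (fun k => Im (a k)) n.
Proof.
  induction n as [|n IH]; [rewrite !sum_O; auto|].
  rewrite !sum_Sn, <- IH. reflexivity.
Qed.

Lemma sum_n_ge_term (a : nat -> R) n k :
  (forall i, (0 <= a i)%R) -> (k <= n)%nat -> (a k <= sum_n a n)%R.
Proof.
  intros Ha Hk. induction n as [|n IH].
  - replace k with O by lia. rewrite sum_O. lra.
  - rewrite sum_Sn. unfold plus; simpl.
    assert (0 <= sum_n a n)%R.
    { clear -Ha. induction n as [|n IH]; [rewrite sum_O; auto|].
      rewrite sum_Sn. unfold plus; simpl. specialize (Ha (S n)). lra. }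
    destruct (Nat.eq_dec k (S n)) as [->|Hne]; [lra|].
    specialize (IH ltac:(lia)). specialize (Ha (S n)). lra.
Qed.

(** Absolute convergence at one point [(y, y)] with [y > 0] bounds every
    coefficient by [M y^-(j+k)]; closer to the origin the square partial sums
    then converge to the iterated sum. *)
Lemma mix_analytic_expansion F :
  mix_analytic_at F 0 0 -> exists c M r, has_expansion F c M r.
Proof.
  intros [c [r0 [Hr0 H]]].
  set (y := Rmin (r0 / 2) 1).
  assert (Hy : (0 < y)%R) by (apply Rmin_glb_lt; lra).
  assert (Hy1 : (y <= r0 / 2)%R) by apply Rmin_l.
  assert (Hy2 : (y <= 1)%R) by apply Rmin_r.
  assert (Hyabs : Rabs y = y) by (apply Rabs_pos_eq; lra).
  destruct (H y (RtoC y)) as [[M HM] _].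
  { rewrite Rminus_0_r, Hyabs. lra. }
  { rewrite <- RtoC_minus, Cmod_R, Rminus_0_r, Hyabs. lra. }
  assert (Hb : double_bounded c M (/ y)).
  { intros j k. rewrite pow_inv.
    apply Rmult_le_reg_r with (y ^ (j + k))%R; [apply pow_lt; auto|].
    rewrite Rmult_assoc, Rinv_l, Rmult_1_r by (apply pow_nonzero; lra).
    apply Rle_trans with (2 := HM (j + k)%nat).
    set (N := (j + k)%nat).
    apply Rle_trans with
      (sum_n (fun k => Cmod (c j k * (RtoC y - 0) ^ j * (RtoC y - 0) ^ k)) N).
    2:{ apply (sum_n_ge_term (fun j => sum_n (fun k =>
                 Cmod (c j k * (RtoC y - 0) ^ j * (RtoC y - 0) ^ k)) N)).
        - intros i.
          apply Rle_trans with (Cmod (c i O * (RtoC y - 0) ^ i * (RtoC y - 0) ^ 0)).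
          apply Cmod_ge_0.
          apply (sum_n_ge_term (fun k =>
            Cmod (c i k * (RtoC y - 0) ^ i * (RtoC y - 0) ^ k))); [|lia].
          intros; apply Cmod_ge_0.
        - unfold N; lia. }
    apply Rle_trans with (Cmod (c j k * (RtoC y - 0) ^ j * (RtoC y - 0) ^ k)).
    2:{ apply (sum_n_ge_term (fun k =>
            Cmod (c j k * (RtoC y - 0) ^ j * (RtoC y - 0) ^ k))).
        intros; apply Cmod_ge_0. unfold N; lia. }
    rewrite <- RtoC_minus, Rminus_0_r, !Cmod_mult, !Cmod_pow, Cmod_R, Hyabs.
    unfold N. rewrite pow_add. right; ring. }
  assert (Hyr : (1 <= / y)%R) by (rewrite <- Rinv_1; apply Rinv_le_contravar; lra).
  exists c, M, (/ y)%R. split; [auto|split; auto].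
  intros t w Ht Hw.
  assert (HM0 : (0 <= M)%R).
  { specialize (Hb O O). pose proof (Cmod_ge_0 (c O O)). simpl in Hb. lra. }
  assert (Hlt : forall x, (/ y * x <= / 4)%R -> (x < r0)%R).
  { intros x Hx. apply Rle_lt_trans with (y / 4)%R; [|lra].
    apply Rmult_le_reg_l with (/ y)%R; [lra|].
    replace (/ y * (y / 4))%R with (/ 4)%R by (field; lra). auto. }
  destruct (H t w) as [_ Hlim].
  { rewrite Rminus_0_r. auto. }
  { replace (w - 0) with w by ring. auto. }
  set (q := Rmax (/ y * Rabs t) (/ y * Cmod w)).
  assert (Hq1 : (/ y * Rabs t <= q)%R) by apply Rmax_l.
  assert (Hq2 : (/ y * Cmod w <= q)%R) by apply Rmax_r.
  assert (Hq : (0 <= q <= / 4)%R).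
  { split; [|apply Rmax_lub; auto].
    apply Rle_trans with (2 := Hq1), Rmult_le_pos; [lra|apply Rabs_pos]. }
  set (a := fun j k => c j k * (RtoC t - 0) ^ j * (w - 0) ^ k) in *.
  assert (Ha : forall j k, (Cmod (a j k) <= M * q ^ (j + k))%R).
  { intros j k. unfold a. replace (w - 0) with w by ring.
    rewrite <- RtoC_minus, Rminus_0_r, !Cmod_mult, !Cmod_pow, Cmod_R.
    apply Rle_trans with (M * (/ y) ^ (j + k) * Rabs t ^ j * Cmod w ^ k)%R.
    - repeat (apply Rmult_le_compat_r; [apply pow_le; auto using Rabs_pos, Cmod_ge_0|]).
      apply Hb.
    - replace (M * (/ y) ^ (j + k) * Rabs t ^ j * Cmod w ^ k)%R
        with (M * ((/ y * Rabs t) ^ j * (/ y * Cmod w) ^ k))%R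
        by (rewrite pow_add, !Rpow_mult_distr; ring).
      apply Rmult_le_compat_l; auto. rewrite pow_add.
      apply Rmult_le_compat; try (apply pow_le); try (apply pow_incr; split; auto);
        apply Rmult_le_pos; try lra; auto using Rabs_pos, Cmod_ge_0. }
  assert (Hcol : forall k, CSeries (fun j => a j k) = slice c t k * w ^ k).
  { intros k. rewrite Cmult_comm. unfold slice, CPSeries.
    rewrite <- (CSeries_scal (w ^ k) _ (M * (/ y) ^ k) (/ y * Rabs t)).
    - apply CSeries_ext. intros j. unfold a.
      replace (w - 0) with w by ring. replace (RtoC t - 0) with (RtoC t) by ring. ring.
    - split; [|lra]. apply Rmult_le_pos; [lra|apply Rabs_pos].
    - rewrite <- (Cmod_R t). apply Cgeom_term; [|lra].
      intros j. apply Rle_trans with (1 := Hb j k). rewrite pow_add. right; ring. }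
  assert (HRe := filterlim_C_fst _ _ Hlim).
  assert (HIm := filterlim_C_snd _ _ Hlim).
  assert (HRe' := double_sum_squares (fun j k => Re (a j k)) M q Hq
    (fun j k => Rle_trans _ _ _ (re_le_Cmod _) (Ha j k))).
  assert (HIm' := double_sum_squares (fun j k => Im (a j k)) M q Hq
    (fun j k => Rle_trans _ _ _ (im_le_Cmod _) (Ha j k))).
  apply is_lim_seq_unique in HRe', HIm'.
  unfold CPSeries. rewrite <- (CSeries_ext _ _ Hcol).
  unfold CSeries at 1.
  rewrite (surjective_pairing (F t w)). f_equal.
  - apply (is_lim_seq_ext _ (fun N => sum_n (fun j => sum_n (fun k => Re (a j k)) N) N)) in HRe.
    + apply is_lim_seq_unique in HRe. rewrite HRe in HRe'. injection HRe'. auto.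
    + intros N. rewrite sum_n_Re. apply sum_n_ext. intros j. apply sum_n_Re.
  - apply (is_lim_seq_ext _ (fun N => sum_n (fun j => sum_n (fun k => Im (a j k)) N) N)) in HIm.
    + apply is_lim_seq_unique in HIm. rewrite HIm in HIm'. injection HIm'. auto.
    + intros N. rewrite sum_n_Im. apply sum_n_ext. intros j. apply sum_n_Im.
Qed.

(** * The invariants as functions of the even and odd parts of the multiplier *)

Lemma on_axis_sqrt_sq eta s : on_axis_sqrt eta s -> s ^ 2 = RtoC eta.
Proof.
  intros [[x [-> <-]]|[y [-> <-]]].
  - symmetry. apply RtoC_pow.
  - unfold RtoC, Cpow, Cmult; simpl. f_equal; ring.
Qed.

Lemma on_axis_sqrt_opp eta s : on_axis_sqrt eta s -> on_axis_sqrt eta (- s).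
Proof.
  intros [[x [-> <-]]|[y [-> <-]]].
  - left. exists (- x)%R. split; [rewrite RtoC_opp; auto|ring].
  - right. exists (- y)%R. split; [unfold Copp; simpl; f_equal; ring|ring].
Qed.

Lemma on_axis_sqrt_csqrt eta : on_axis_sqrt eta (csqrt eta).
Proof.
  unfold csqrt. destruct (Rle_lt_dec 0 eta) as [H|H].
  - left. exists (sqrt eta). rewrite (sqrt_neg_0 (- eta)) by lra.
    split; auto. apply pow2_sqrt; auto.
  - right. exists (sqrt (- eta)). rewrite (sqrt_neg_0 eta) by lra.
    split; auto. rewrite pow2_sqrt; lra.
Qed.

Lemma Re_pos_on_axis (A B eta : R) (s : C) :
  on_axis_sqrt eta s -> (0 < A)%R -> (Rabs eta * (B / A) ^ 2 < / 4)%R ->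
  (0 < Re (RtoC A + s * RtoC B))%R.
Proof.
  intros Hs HA Hsmall.
  set (T := (B / A)%R) in *.
  assert (HB : B = (A * T)%R) by (unfold T; field; lra).
  destruct Hs as [[x [-> Hx]]|[y [-> Hy]]]; simpl.
  - rewrite <- Hx, <- RPow_abs, pow2_abs in Hsmall.
    assert (HxT : (Rabs (x * T) < / 2)%R) by (apply Rabs_lt_of_sq; lra).
    apply Rabs_def2 in HxT. rewrite HB. nra.
  - lra.
Qed.

Lemma locally_pos (u : R -> R) :
  continuous u 0%R -> (0 < u 0)%R -> locally 0%R (fun x => (0 < u x)%R).
Proof.
  intros Hc H. apply (Hc (fun y => (0 < y)%R)).
  apply (locally_open (fun y => (0 < y)%R)); auto. apply open_gt.
Qed.

Lemma RtoC_neq_0 (x : R) : x <> 0%R -> RtoC x <> 0.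
Proof. intros Hx E. apply Hx, RtoC_inj, E. Qed.

(** Here [s^2 p + s q] and [s^2 p - s q] stand for the two logarithms; their
    product is [s^2 (s^2 p^2 - q^2)]. *)
Lemma inverse_logs_algebra (s p q : C) :
  s <> 0 -> q <> 0 -> s ^ 2 * p ^ 2 - q ^ 2 <> 0 ->
  let l1 := s ^ 2 * p + s * q in
  let l2 := s ^ 2 * p - s * q in
  l1 <> 0 /\ l2 <> 0 /\ / l1 - / l2 <> 0 /\
  / l1 + / l2 = 2 * p / (s ^ 2 * p ^ 2 - q ^ 2) /\
  / ((/ l1 - / l2) ^ 2) = s ^ 2 * (s ^ 2 * p ^ 2 - q ^ 2) ^ 2 / (4 * q ^ 2).
Proof.
  intros Hs Hq HW l1 l2.
  assert (Hf : s ^ 2 * p ^ 2 - q ^ 2 = (s * p + q) * (s * p - q)) by ring.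
  assert (H1 : s * p + q <> 0).
  { intros E. apply HW. rewrite Hf, E. ring. }
  assert (H2 : s * p - q <> 0).
  { intros E. apply HW. rewrite Hf, E. ring. }
  assert (Hl1 : l1 = s * (s * p + q)) by (unfold l1; ring).
  assert (Hl2 : l2 = s * (s * p - q)) by (unfold l2; ring).
  assert (Htwo : RtoC 2 <> 0) by (apply RtoC_neq_0; lra).
  assert (Hd : / l1 - / l2 = - (2) * q / (s * ((s * p + q) * (s * p - q)))).
  { rewrite Hl1, Hl2. field. auto. }
  assert (Hdn : / l1 - / l2 <> 0).
  { intros E. apply (Cmult_neq_0 2 q); auto.
    replace (2 * q) with (- (/ l1 - / l2) * (s * ((s * p + q) * (s * p - q)))).
    - rewrite E. ring.
    - rewrite Hd. field. auto. }
  repeat split; auto.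
  - rewrite Hl1. apply Cmult_neq_0; auto.
  - rewrite Hl2. apply Cmult_neq_0; auto.
  - rewrite Hf, Hl1, Hl2. field. auto.
  - rewrite Hd, Hf. field. auto.
Qed.

(** The logarithms of [A + s B] and [A - s B] are [eta P1 + s Q] and
    [eta P1 - s Q], with [P1], [Q] analytic in [eta = s^2], so the symmetric
    combinations of their inverses are rational in [eta], [P1], [Q], with
    denominators that are non-zero at 0 because [Q] is 2 there. *)
Lemma canonical_invariants (A B : R -> R) (a1 : R) :
  analytic A -> analytic B -> A 0%R = 1%R -> B 0%R = 2%R -> is_derive A 0%R a1 ->
  exists E H : R -> R, analytic E /\ analytic H /\
    E 0%R = 0%R /\ H 0%R = ((2 - a1) / 2)%R /\
    locally 0%R (fun eta => eta <> 0%R -> forall s, on_axis_sqrt eta s ->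
      let m1 := RtoC (A eta) + s * RtoC (B eta) in
      let m2 := RtoC (A eta) + - s * RtoC (B eta) in
      (0 < Re m1)%R /\ (0 < Re m2)%R /\
      Clog m1 <> 0 /\ Clog m2 <> 0 /\ / Clog m1 - / Clog m2 <> 0 /\
      / ((/ Clog m1 - / Clog m2) ^ 2) = RtoC (E eta) /\
      / Clog m1 + / Clog m2 = RtoC (H eta)).
Proof.
  intros HA HB HA0 HB0 Ha1.
  set (N := fun x => (A x ^ 2 - x * B x ^ 2)%R).
  set (P := fun x => (ln (N x) / 2)%R).
  set (T := fun x => (B x / A x)%R).
  set (Z := fun x => (x * T x ^ 2)%R).
  set (Q := fun x => (T x * artanh_sqrt (Z x))%R).
  assert (Hsq : forall u, analytic u -> analytic (fun x => u x ^ 2)%R).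
  { intros u Hu. apply analytic_ext with (fun x => u x * u x)%R.
    intros; ring. apply analytic_mult; auto. }
  assert (HN : analytic N).
  { apply analytic_minus; auto. apply analytic_mult; auto. apply analytic_id. }
  assert (HN0 : N 0%R = 1%R) by (unfold N; rewrite HA0; ring).
  assert (HP : analytic P).
  { apply analytic_mult; [apply analytic_ln; auto|apply analytic_const]. }
  assert (HP0 : P 0%R = 0%R) by (unfold P; rewrite HN0, ln_1; field).
  assert (HT : analytic T) by (apply analytic_div; auto; lra).
  assert (HZ : analytic Z) by (apply analytic_mult; auto; apply analytic_id).
  assert (HZ0 : Z 0%R = 0%R) by (unfold Z; ring).
  assert (HQ : analytic Q).
  { apply analytic_mult; auto. apply (analytic_comp artanh_sqrt Z); auto.
    apply analytic_artanh_sqrt. }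
  assert (HQ0 : Q 0%R = 2%R).
  { unfold Q. rewrite HZ0, artanh_sqrt_0. unfold T. rewrite HA0, HB0. field. }
  destruct (analytic_factor_id P HP HP0) as [P1 [HP1 [HPP1 HdP]]].
  (* [P1 0] is the derivative of [P] at 0, and N' = 2 A A' - B^2 there. *)
  assert (HP10 : P1 0%R = (a1 - 2)%R).
  { destruct (analytic_is_derive B HB) as [b1 Hb1].
    rewrite <- (is_derive_unique _ _ _ HdP). apply is_derive_unique.
    unfold P, N. auto_derive.
    - split; [eexists; eauto|split; [eexists; eauto|]]. split; auto.
      rewrite HA0. lra.
    - change (Derive (fun x => A x) 0%R) with (Derive A 0%R).
      rewrite HA0, HB0, (is_derive_unique _ _ _ Ha1). field. }
  set (W := fun x => (x * P1 x ^ 2 - Q x ^ 2)%R).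
  assert (HW : analytic W).
  { apply analytic_minus; auto. apply analytic_mult; auto. apply analytic_id. }
  assert (HW0 : W 0%R = (-4)%R) by (unfold W; rewrite HQ0; ring).
  exists (fun x => x * W x ^ 2 / (4 * Q x ^ 2))%R, (fun x => 2 * P1 x / W x)%R.
  split; [|split; [|split; [|split]]].
  - apply analytic_div.
    + apply analytic_mult; auto. apply analytic_id.
    + apply analytic_scal; auto.
    + rewrite HQ0. lra.
  - apply analytic_div; auto. apply analytic_scal; auto. lra.
  - unfold Rdiv; ring.
  - rewrite HP10, HW0. field.
  - assert (LA : locally 0%R (fun x => (0 < A x)%R)).
    { apply locally_pos; [apply analytic_continuous; auto|lra]. }
    assert (LW : locally 0%R (fun x => (0 < - W x)%R)).
    { apply (locally_pos (fun x => - W x)%R); [|lra].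
      apply analytic_continuous, analytic_opp; auto. }
    assert (LQ : locally 0%R (fun x => (0 < Q x)%R)).
    { apply locally_pos; [apply analytic_continuous; auto|lra]. }
    assert (LZ : locally 0%R (fun x => (1 * Rabs (2 * Z x) < / 2)%R)).
    { assert (Hc := analytic_continuous _ (analytic_scal 2 Z HZ)).
      apply (Hc (fun y => (1 * Rabs y < / 2)%R)). rewrite HZ0, Rmult_0_r.
      apply locally_0_geom; lra. }
    generalize (filter_and _ _ (filter_and _ _ LA LW)
      (filter_and _ _ (filter_and _ _ LQ LZ) HPP1)).
    apply filter_imp. intros x [[H1 H2] [[H3 H4] H5]] Hx s Hs m1 m2.
    assert (Hsmall : (Rabs x * (B x / A x) ^ 2 < / 4)%R).
    { fold (T x). unfold Z in H4.
      rewrite !Rabs_mult, <- RPow_abs, pow2_abs, (Rabs_pos_eq 2) in H4 by lra. lra. }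
    assert (Hs' := on_axis_sqrt_opp _ _ Hs).
    assert (Hss := on_axis_sqrt_sq _ _ Hs).
    split; [apply Re_pos_on_axis with x; auto|].
    split; [apply Re_pos_on_axis with x; auto|].
    assert (Hl1 : Clog m1 = s ^ 2 * RtoC (P1 x) + s * RtoC (Q x)).
    { unfold m1. rewrite (Clog_even_odd _ _ x) by auto.
      fold (N x) (T x) (Z x) (P x) (Q x). change (ln (N x) / 2)%R with (P x).
      rewrite H5, RtoC_mult, Hss. auto. }
    assert (Hl2 : Clog m2 = s ^ 2 * RtoC (P1 x) - s * RtoC (Q x)).
    { unfold m2. rewrite (Clog_even_odd _ _ x) by auto.
      fold (N x) (T x) (Z x) (P x) (Q x). change (ln (N x) / 2)%R with (P x).
      rewrite H5, RtoC_mult, Hss. ring. }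
    assert (HWC : s ^ 2 * RtoC (P1 x) ^ 2 - RtoC (Q x) ^ 2 = RtoC (W x)).
    { unfold W. rewrite RtoC_minus, RtoC_mult, !RtoC_pow, Hss. auto. }
    destruct (inverse_logs_algebra s (RtoC (P1 x)) (RtoC (Q x)))
      as [K1 [K2 [K3 [K4 K5]]]].
    + intros E. apply Hx. apply RtoC_inj. rewrite <- Hss, E. simpl. ring.
    + apply RtoC_neq_0. lra.
    + rewrite HWC. apply RtoC_neq_0. lra.
    + rewrite <- Hl1, <- Hl2 in *.
      repeat (split; [assumption|]). split.
      * rewrite K5, HWC, Hss, RtoC_div, !RtoC_mult, !RtoC_pow by nra. auto.
      * rewrite K4, HWC, RtoC_div, RtoC_mult by lra. auto.
Qed.

(** * Expansions of families at the origin *)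

Lemma double_bounded_nonneg c M r : double_bounded c M r -> (0 <= M)%R.
Proof.
  intros H. specialize (H O O). pose proof (Cmod_ge_0 (c O O)). simpl in H. lra.
Qed.

Lemma slice_near_0 c M r t k :
  double_bounded c M r -> (0 <= r)%R -> (r * Rabs t <= / 2)%R ->
  (Cmod (slice c t k - c O k) <= 4 * (M * r ^ k * r) * Rabs t)%R.
Proof.
  intros Hc Hr Ht. rewrite <- (Cmod_R t). apply (CPSeries_near_0 (fun j => c j k)); auto.
  - intros j. apply Rle_trans with (1 := Hc j k). rewrite pow_add. right; ring.
  - rewrite Cmod_R; auto.
Qed.

Lemma CPSeries_slice_near_0 c M r t w :
  double_bounded c M r -> (0 <= r)%R ->
  (r * Rabs t <= / 2)%R -> (r * Cmod w <= / 2)%R ->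
  (Cmod (CPSeries (slice c t) w - c O O) <= 16 * M * r * (Rabs t + Cmod w))%R.
Proof.
  intros Hc Hr Ht Hw. pose proof (double_bounded_nonneg _ _ _ Hc).
  replace (CPSeries (slice c t) w - c O O)
    with ((CPSeries (slice c t) w - slice c t O) + (slice c t O - c O O)) by ring.
  apply Rle_trans with (1 := Cmod_triangle _ _).
  assert (H1 := CPSeries_near_0 _ _ _ w (Cgeom_slice c M r t Hc Hr Ht) Hr Hw).
  assert (H2 := slice_near_0 c M r t 0 Hc Hr Ht). simpl in H2.
  assert (0 <= M * r * Rabs t)%R by (repeat apply Rmult_le_pos; auto using Rabs_pos).
  lra.
Qed.

Definition double_derive (c : nat -> nat -> C) (j k : nat) : C :=
  RtoC (INR (S k)) * c j (S k).

Lemma double_bounded_derive c M r :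
  double_bounded c M r -> (0 <= r)%R ->
  double_bounded (double_derive c) (2 * M * r) (2 * r).
Proof.
  intros Hc Hr j k. pose proof (double_bounded_nonneg _ _ _ Hc) as HM.
  assert (H := Cgeom_CPS_derive (c j) (M * r ^ j) r).
  unfold CPS_derive in H. unfold double_derive.
  apply Rle_trans with (2 * (M * r ^ j) * r * (2 * r) ^ k)%R.
  - apply H; auto. intros i. apply Rle_trans with (1 := Hc j i).
    rewrite pow_add. right; ring.
  - rewrite pow_add.
    replace (2 * (M * r ^ j) * r * (2 * r) ^ k)%R
      with (2 * M * r * (r ^ j * (2 * r) ^ k))%R by ring.
    apply Rmult_le_compat_l; [repeat apply Rmult_le_pos; lra|].
    apply Rmult_le_compat_r; [apply pow_le; lra|]. apply pow_incr; lra.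
Qed.

Lemma slice_derive c M r t k :
  double_bounded c M r -> (0 <= r)%R -> (r * Rabs t <= / 2)%R ->
  CPS_derive (slice c t) k = slice (double_derive c) t k.
Proof.
  intros Hc Hr Ht. unfold CPS_derive, slice, CPSeries, double_derive.
  rewrite <- (CSeries_scal (RtoC (INR (S k))) _ (M * r ^ S k) (r * Cmod (RtoC t))).
  - apply CSeries_ext. intros j. ring.
  - rewrite Cmod_R. split; auto. apply Rmult_le_pos; auto using Rabs_pos.
  - apply Cgeom_term; auto. intros j. apply Rle_trans with (1 := Hc j (S k)).
    rewrite pow_add. right; ring.
Qed.

Definition partial_w (c : nat -> nat -> C) (t : R) (w : C) : C :=
  CPSeries (slice (double_derive c) t) w.

Lemma has_expansion_taylor2 F c M r t w :
  has_expansion F c M r -> (r * Rabs t <= / 4)%R -> (r * Cmod w < / 4)%R ->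
  taylor2 (F t) w (partial_w c t w).
Proof.
  intros [Hr [Hc HF]] Ht Hw.
  pose proof (double_bounded_nonneg _ _ _ Hc) as HM.
  exists (64 * (4 * M) * r ^ 2)%R, ((/ 4 - r * Cmod w) / r)%R.
  split; [apply Rdiv_lt_0_compat; lra|].
  split; [repeat apply Rmult_le_pos; try lra; apply pow2_ge_0|].
  intros w' Hw'.
  assert (Hw2 : (r * Cmod w' <= / 4)%R).
  { apply (Rmult_lt_compat_l r) in Hw'; [|lra].
    replace (r * ((/ 4 - r * Cmod w) / r))%R with (/ 4 - r * Cmod w)%R in Hw'
      by (field; lra).
    replace w' with (w + (w' - w)) by ring.
    apply Rle_trans with (r * (Cmod w + Cmod (w' - w)))%R; [|lra].
    apply Rmult_le_compat_l; [lra|apply Cmod_triangle]. }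
  rewrite !HF by (auto; lra).
  replace (partial_w c t w) with (CPSeries (CPS_derive (slice c t)) w).
  - apply CPSeries_taylor2; auto; try lra. apply Cgeom_slice; auto; lra.
  - apply CSeries_ext. intros k. rewrite (slice_derive c M r) by (auto; lra). auto.
Qed.

(** ** Restriction to the parabola t = s^2 *)

Definition even_columns (c : nat -> nat -> C) (j k : nat) : C := c j (2 * k)%nat.
Definition odd_columns (c : nat -> nat -> C) (j k : nat) : C := c j (2 * k + 1)%nat.

Definition diagonal (c : nat -> nat -> C) (t : R) : C := CPSeries (slice c t) (RtoC t).

Lemma double_bounded_columns c M r i :
  double_bounded c M r -> (1 <= r)%R ->
  double_bounded (fun j k => c j (2 * k + i)%nat) (M * r ^ i) (r ^ 2).
Proof.
  intros Hc Hr j k. pose proof (double_bounded_nonneg _ _ _ Hc).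
  apply Rle_trans with (1 := Hc _ _).
  rewrite <- pow_mult, Rmult_assoc, <- pow_add.
  apply Rmult_le_compat_l; auto. apply Rle_pow; auto. lia.
Qed.

Lemma double_bounded_even c M r :
  double_bounded c M r -> (1 <= r)%R -> double_bounded (even_columns c) M (r ^ 2).
Proof.
  intros Hc Hr j k. assert (H := double_bounded_columns c M r 0 Hc Hr j k).
  simpl (r ^ 0)%R in H. rewrite Rmult_1_r, Nat.add_0_r in H. exact H.
Qed.

Lemma double_bounded_odd c M r :
  double_bounded c M r -> (1 <= r)%R ->
  double_bounded (odd_columns c) (M * r ^ 1) (r ^ 2).
Proof. apply double_bounded_columns. Qed.

(** Since [w^(2k) = t^k] when [w = s], the even part in [s] is the sum along the
    diagonal [w = t] of the series made of the even columns, and similarly for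
    the odd part. *)
Lemma CPSeries_slice_even_odd c M r t s :
  double_bounded c M r -> (0 <= r)%R -> (r * Rabs t <= / 2)%R -> (r * Cmod s <= / 2)%R ->
  s ^ 2 = RtoC t ->
  CPSeries (slice c t) s =
  diagonal (even_columns c) t + s * diagonal (odd_columns c) t.
Proof.
  intros Hc Hr Ht Hs Hst.
  apply (CPSeries_even_odd (slice c t) (4 * M) r s (RtoC t)); auto.
  apply Cgeom_slice; auto.
Qed.

Lemma Re_mult_RtoC (z : C) (x : R) : Re (z * RtoC x) = (Re z * x)%R.
Proof. unfold Re, Im; simpl. ring. Qed.

Lemma Im_mult_RtoC (z : C) (x : R) : Im (z * RtoC x) = (Im z * x)%R.
Proof. unfold Re, Im; simpl. ring. Qed.

Lemma analytic_diagonal_Re c M r :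
  double_bounded c M r -> (0 < r)%R ->
  analytic (fun t => Re (diagonal c t)) /\ Re (diagonal c 0%R) = Re (c O O) /\
  is_derive (fun t => Re (diagonal c t)) 0%R (Re (c 1%nat O) + Re (c O 1%nat))%R.
Proof.
  intros Hc Hr.
  apply (analytic_antidiagonals (fun j k => Re (c j k)) M r); auto.
  - intros j k. apply Rle_trans with (1 := re_le_Cmod _), Hc.
  - apply filter_forall. intros t. apply Series_ext. intros k.
    rewrite <- RtoC_pow, Re_mult_RtoC, Rmult_comm. f_equal.
    apply Series_ext. intros j. rewrite <- RtoC_pow, Re_mult_RtoC. auto.
Qed.

Lemma analytic_diagonal_Im c M r :
  double_bounded c M r -> (0 < r)%R ->
  analytic (fun t => Im (diagonal c t)) /\ Im (diagonal c 0%R) = Im (c O O) /\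
  is_derive (fun t => Im (diagonal c t)) 0%R (Im (c 1%nat O) + Im (c O 1%nat))%R.
Proof.
  intros Hc Hr.
  apply (analytic_antidiagonals (fun j k => Im (c j k)) M r); auto.
  - intros j k. apply Rle_trans with (1 := im_le_Cmod _), Hc.
  - apply filter_forall. intros t. apply Series_ext. intros k.
    rewrite <- RtoC_pow, Im_mult_RtoC, Rmult_comm. f_equal.
    apply Series_ext. intros j. rewrite <- RtoC_pow, Im_mult_RtoC. auto.
Qed.

(** ** Recovering coefficients *)

Definition right_little_o (u : R -> C) (m : nat) : Prop :=
  forall eps, (0 < eps)%R -> exists d, (0 < d)%R /\
    forall x, (0 < x < d)%R -> (Cmod (u x) <= eps * x ^ m)%R.

Lemma coefficient_0_unique d M r a (p : R -> C) Bp m :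
  Cgeom d M r -> (0 < r)%R -> (forall x, (0 < x < 1)%R -> (Cmod (p x) <= Bp)%R) ->
  right_little_o (fun x => CPSeries d (RtoC x) - (a + RtoC x * p x)) m ->
  d O = a.
Proof.
  intros Hd Hr Hp Ho.
  pose proof (Cgeom_nonneg _ _ _ Hd) as HM.
  assert (HBp : (0 <= Bp)%R).
  { apply Rle_trans with (2 := Hp (/ 2)%R ltac:(lra)), Cmod_ge_0. }
  cut (Cmod (d O - a) <= 0)%R.
  { intros H.
    assert (E : d O - a = 0).
    { apply Cmod_eq_0. pose proof (Cmod_ge_0 (d O - a)). lra. }
    replace (d O) with (d O - a + a) by ring. rewrite E. ring. }
  apply le_epsilon. intros eps Heps.
  destruct (Ho (eps / 2)%R ltac:(lra)) as [e [He H]].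
  set (K := (4 * (M * r) + Bp + 1)%R).
  assert (HK : (0 < K)%R).
  { unfold K. assert (0 <= M * r)%R by (apply Rmult_le_pos; lra). lra. }
  set (x := Rmin (Rmin (e / 2) (/ 2)) (Rmin (/ (2 * r)) (eps / (2 * K)))).
  assert (Hx1 : (x <= e / 2)%R) by (unfold x; eapply Rle_trans; apply Rmin_l).
  assert (Hx2 : (x <= / 2)%R).
  { unfold x. eapply Rle_trans; [apply Rmin_l|apply Rmin_r]. }
  assert (Hx3 : (x <= / (2 * r))%R).
  { unfold x. eapply Rle_trans; [apply Rmin_r|apply Rmin_l]. }
  assert (Hx4 : (x <= eps / (2 * K))%R).
  { unfold x. eapply Rle_trans; [apply Rmin_r|apply Rmin_r]. }
  assert (Hx0 : (0 < x)%R).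
  { unfold x. repeat apply Rmin_glb_lt; try lra.
    - apply Rinv_0_lt_compat; lra.
    - apply Rdiv_lt_0_compat; lra. }
  assert (Hxr : (r * Cmod (RtoC x) <= / 2)%R).
  { rewrite Cmod_R, Rabs_pos_eq by lra. apply (Rmult_le_compat_l r) in Hx3; [|lra].
    replace (r * / (2 * r))%R with (/ 2)%R in Hx3 by (field; lra). auto. }
  assert (H1 := CPSeries_near_0 d M r (RtoC x) Hd ltac:(lra) Hxr).
  rewrite Cmod_R, (Rabs_pos_eq x) in H1 by lra.
  specialize (H x ltac:(lra)). specialize (Hp x ltac:(lra)).
  replace (d O - a) with
    (- (CPSeries d (RtoC x) - d O) + ((CPSeries d (RtoC x) - (a + RtoC x * p x))
      + RtoC x * p x)) by ring.
  apply Rle_trans with (1 := Cmod_triangle _ _). rewrite Cmod_opp.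
  apply Rle_trans with (4 * (M * r) * x + (eps / 2 * 1 + x * Bp))%R.
  - apply Rplus_le_compat; auto. apply Rle_trans with (1 := Cmod_triangle _ _).
    apply Rplus_le_compat.
    + apply Rle_trans with (1 := H). apply Rmult_le_compat_l; [lra|].
      rewrite <- (pow1 m). apply pow_incr. lra.
    + rewrite Cmod_mult, Cmod_R, Rabs_pos_eq by lra.
      apply Rmult_le_compat_l; lra.
  - assert (x * K <= eps / 2)%R.
    { apply (Rmult_le_compat_r K) in Hx4; [|lra].
      replace (eps / (2 * K) * K)%R with (eps / 2)%R in Hx4 by (field; lra). auto. }
    unfold K in *. nra.
Qed.

Lemma right_little_o_shift d M r (p : R -> C) m :
  Cgeom d M r -> (0 < r)%R ->
  right_little_o (fun x => CPSeries d (RtoC x) - (d O + RtoC x * p x)) (S m) ->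
  right_little_o (fun x => CPSeries (fun k => d (S k)) (RtoC x) - p x) m.
Proof.
  intros Hd Hr Ho eps Heps. destruct (Ho eps Heps) as [e [He H]].
  exists (Rmin e (/ (2 * r))).
  split; [apply Rmin_glb_lt; auto; apply Rinv_0_lt_compat; lra|].
  intros x [Hx Hxe].
  assert (Hx1 : (x < e)%R) by (apply Rlt_le_trans with (1 := Hxe), Rmin_l).
  assert (Hx3 : (x < / (2 * r))%R) by (apply Rlt_le_trans with (1 := Hxe), Rmin_r).
  specialize (H x (conj Hx Hx1)).
  assert (Hxr : (r * Cmod (RtoC x) <= / 2)%R).
  { rewrite Cmod_R, Rabs_pos_eq by lra. apply (Rmult_lt_compat_l r) in Hx3; [|lra].
    replace (r * / (2 * r))%R with (/ 2)%R in Hx3 by (field; lra). lra. }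
  rewrite (CPSeries_shift d M r) in H by (auto; lra).
  apply Rmult_le_reg_l with x; auto.
  rewrite <- (Rabs_pos_eq x) at 1 by lra. rewrite <- Cmod_R, <- Cmod_mult.
  replace (RtoC x * (CPSeries (fun k => d (S k)) (RtoC x) - p x))
    with (d O + RtoC x * CPSeries (fun k => d (S k)) (RtoC x) - (d O + RtoC x * p x))
    by ring.
  apply Rle_trans with (1 := H). simpl. right; ring.
Qed.

(** A polynomial in Horner form, so that each step compares the constant terms
    and divides by [x]. *)
Lemma coefficients_of_cubic_expansion d M r a0 a1 a2 a3 :
  Cgeom d M r -> (0 < r)%R ->
  right_little_o (fun x => CPSeries d (RtoC x) -
    (a0 + RtoC x * (a1 + RtoC x * (a2 + RtoC x * (a3 + RtoC x * 0))))) 3 ->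
  d 0%nat = a0 /\ d 1%nat = a1 /\ d 2%nat = a2 /\ d 3%nat = a3.
Proof.
  intros Hd Hr Ho.
  assert (Hd' : forall e M', Cgeom e M' r -> Cgeom (fun k => e (S k)) (M' * r) r).
  { intros e M' He k. apply Rle_trans with (1 := He (S k)). simpl. right; ring. }
  assert (Hp : forall a (p : R -> C) Bp,
    (forall x, (0 < x < 1)%R -> (Cmod (p x) <= Bp)%R) ->
    (forall x, (0 < x < 1)%R -> (Cmod (a + RtoC x * p x) <= Cmod a + Bp)%R)).
  { intros a p Bp H x Hx. apply Rle_trans with (1 := Cmod_triangle _ _).
    apply Rplus_le_compat_l. specialize (H x Hx). pose proof (Cmod_ge_0 (p x)).
    rewrite Cmod_mult, Cmod_R, Rabs_pos_eq by lra. nra. }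
  assert (B0 : forall x, (0 < x < 1)%R -> (Cmod ((fun _ : R => RtoC 0) x) <= 0)%R).
  { intros x _. rewrite Cmod_0. lra. }
  assert (B3 := Hp a3 _ _ B0). assert (B2 := Hp a2 _ _ B3). assert (B1 := Hp a1 _ _ B2).
  assert (E0 := coefficient_0_unique _ _ _ _ _ _ _ Hd Hr B1 Ho).
  rewrite <- E0 in Ho. apply (right_little_o_shift _ _ _ _ _ Hd Hr) in Ho.
  apply Hd' in Hd.
  assert (E1 := coefficient_0_unique _ _ _ _ _ _ _ Hd Hr B2 Ho).
  rewrite <- E1 in Ho.
  apply (right_little_o_shift _ _ _ (fun x => a2 + RtoC x * (a3 + RtoC x * 0)) _ Hd Hr) in Ho.
  apply Hd' in Hd.
  assert (E2 := coefficient_0_unique _ _ _ _ _ _ _ Hd Hr B3 Ho).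
  rewrite <- E2 in Ho.
  apply (right_little_o_shift _ _ _ (fun x => a3 + RtoC x * 0) _ Hd Hr) in Ho.
  apply Hd' in Hd.
  assert (E3 := coefficient_0_unique _ _ _ _ _ _ _ Hd Hr B0 Ho).
  auto.
Qed.

(** One-sided information suffices for a function known to be differentiable;
    for [t < 0] the points [+-sqrt t] are exchanged instead of fixed. *)
Lemma right_constant_derive (u : R -> R) (l : R) :
  is_derive u 0%R l -> (exists d, (0 < d)%R /\ forall x, (0 <= x < d)%R -> u x = u 0%R) ->
  l = 0%R.
Proof.
  intros Hu [d [Hd H]]. apply is_derive_Reals in Hu.
  apply Rabs_eq_0. apply Rle_antisym; [|apply Rabs_pos].
  apply le_epsilon. intros eps Heps.
  destruct (Hu eps Heps) as [e He].
  set (x := (Rmin d e / 2)%R).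
  assert (Hx : (0 < x)%R).
  { unfold x. assert (0 < Rmin d e)%R; [|lra]. apply Rmin_glb_lt; auto. apply cond_pos. }
  assert (x < d)%R by (pose proof (Rmin_l d e); unfold x in *; lra).
  assert (x < e)%R by (pose proof (Rmin_r d e); unfold x in *; lra).
  specialize (He x ltac:(lra) ltac:(rewrite Rabs_pos_eq; lra)).
  rewrite Rplus_0_l, (H x) in He by lra.
  replace ((u 0 - u 0) / x - l)%R with (- l)%R in He by (field; lra).
  rewrite Rabs_Ropp in He. lra.
Qed.

(** * Multipliers of the second iterate *)

Lemma near_origin_Cmod (P : R -> C -> Prop) :
  near_origin P -> exists d, (0 < d)%R /\
    forall t z, (Rabs t < d)%R -> (Cmod z < d)%R -> P t z.
Proof.
  intros [d H]. exists d. split; [apply cond_pos|].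
  intros t z Ht Hz. apply (H (t, z)).
  split; [|split]; simpl.
  - change (Rabs (t - 0) < d)%R. rewrite Rminus_0_r. auto.
  - change (Rabs (Re z - 0) < d)%R. rewrite Rminus_0_r.
    apply Rle_lt_trans with (1 := re_le_Cmod z); auto.
  - change (Rabs (Im z - 0) < d)%R. rewrite Rminus_0_r.
    apply Rle_lt_trans with (1 := im_le_Cmod z); auto.
Qed.

Lemma locally_C_Cmod (P : C -> Prop) :
  locally (RtoC 0) P -> exists d, (0 < d)%R /\ forall z, (Cmod z < d)%R -> P z.
Proof.
  intros [d H]. exists d. split; [apply cond_pos|].
  intros z Hz. apply H. split; simpl.
  - change (Rabs (Re z - 0) < d)%R. rewrite Rminus_0_r.
    apply Rle_lt_trans with (1 := re_le_Cmod z); auto.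
  - change (Rabs (Im z - 0) < d)%R. rewrite Rminus_0_r.
    apply Rle_lt_trans with (1 := im_le_Cmod z); auto.
Qed.

Lemma locally_Rabs_lt d : (0 < d)%R -> locally 0%R (fun t => (Rabs t < d)%R).
Proof. intros Hd. apply locally_0_abs. exists d. auto. Qed.

Lemma locally_on_axis_sqrt_small d :
  (0 < d)%R -> locally 0%R (fun t => forall s, on_axis_sqrt t s -> (Cmod s < d)%R).
Proof.
  intros Hd. apply locally_0_abs. exists (d ^ 2)%R. split; [apply pow_lt; auto|].
  intros t Ht s Hs. apply on_axis_sqrt_sq in Hs.
  rewrite <- (Rabs_pos_eq (Cmod s)) by apply Cmod_ge_0.
  apply Rabs_lt_of_sq; auto.
  rewrite <- Cmod_pow, Hs, Cmod_R. auto.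
Qed.

Definition conj_variable (f : R -> C -> C) (t : R) (w : C) : C := f t (Cconj w).

Lemma mix_anti_analytic_expansion f :
  mix_anti_analytic_at f 0 0 ->
  exists c M r, has_expansion (conj_variable f) c M r.
Proof.
  intros [c [r [Hr H]]]. apply mix_analytic_expansion. exists c, r. split; auto.
  intros t w Ht Hw.
  assert (E0 : Cconj 0 = 0) by (unfold Cconj, RtoC; simpl; f_equal; ring).
  assert (H' := H t (Cconj w) Ht).
  rewrite Cconj_conj, E0 in H'. apply H'.
  replace (Cconj w - 0) with (Cconj (w - 0)); [rewrite Cmod_conj; auto|].
  rewrite Cminus_conj, E0. auto.
Qed.

(** An antiholomorphic map is a holomorphic one after conjugation of the
    variable; conjugating twice makes the second iterate holomorphic. *)
Lemma taylor2_second_iterate f c M r t z :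
  has_expansion (conj_variable f) c M r ->
  (r * Rabs t <= / 4)%R -> (r * Cmod z < / 4)%R -> (r * Cmod (f t z) < / 4)%R ->
  taylor2 (second_iterate f t) z (partial_w c t (Cconj (f t z)) * Cconj (partial_w c t (Cconj z))).
Proof.
  intros HF Ht Hz Hfz.
  assert (H1 : taylor2 (fun x => Cconj (conj_variable f t (Cconj x))) z
                 (Cconj (partial_w c t (Cconj z)))).
  { apply taylor2_conj. apply (has_expansion_taylor2 _ c M r); auto.
    rewrite Cmod_conj; auto. }
  assert (Hv : forall x, conj_variable f t (Cconj x) = f t x).
  { intros x. unfold conj_variable. rewrite Cconj_conj. auto. }
  assert (H2 : taylor2 (conj_variable f t) (Cconj (conj_variable f t (Cconj z)))
                 (partial_w c t (Cconj (f t z)))).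
  { rewrite Hv. apply (has_expansion_taylor2 _ c M r); auto.
    rewrite Cmod_conj; auto. }
  apply (taylor2_ext_loc _ _ _ _ 1 Rlt_0_1) with
    (2 := taylor2_comp _ _ _ _ _ H1 H2).
  intros x _. rewrite Hv. unfold conj_variable. rewrite Cconj_conj. auto.
Qed.

Lemma has_expansion_near_0 F c M r t w :
  has_expansion F c M r -> (r * Rabs t <= / 4)%R -> (r * Cmod w <= / 4)%R ->
  (Cmod (F t w - c O O) <= 16 * M * r * (Rabs t + Cmod w))%R.
Proof.
  intros [Hr [Hc HF]] Ht Hw. rewrite HF by auto.
  apply CPSeries_slice_near_0; auto; lra.
Qed.

Lemma has_expansion_origin F c M r : has_expansion F c M r -> F 0%R 0 = c O O.
Proof.
  intros HF.
  assert (H := has_expansion_near_0 F c M r 0%R 0 HF).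
  rewrite Rabs_R0, Cmod_0, Rplus_0_r, !Rmult_0_r in H.
  assert (E : F 0%R 0 - c O O = 0).
  { apply Cmod_eq_0. apply Rle_antisym; [apply H; lra|apply Cmod_ge_0]. }
  replace (F 0%R 0) with (F 0%R 0 - c O O + c O O) by ring. rewrite E. ring.
Qed.

Lemma has_expansion_continuous F c M r d :
  has_expansion F c M r -> (0 < d)%R ->
  exists e, (0 < e)%R /\ forall t w,
    (Rabs t < e)%R -> (Cmod w < e)%R -> (Cmod (F t w - F 0%R 0) < d)%R.
Proof.
  intros HF Hd. rewrite (has_expansion_origin F c M r HF).
  pose proof HF as [Hr [Hc _]].
  pose proof (double_bounded_nonneg _ _ _ Hc) as HM.
  set (K := (16 * M * r)%R).
  assert (HK : (0 <= K)%R) by (unfold K; repeat apply Rmult_le_pos; lra).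
  exists (Rmin (/ (4 * r)) (d / (2 * (K + 1)))).
  split.
  { apply Rmin_glb_lt; [apply Rinv_0_lt_compat; lra|apply Rdiv_lt_0_compat; lra]. }
  assert (Hsm : forall x, (x < Rmin (/ (4 * r)) (d / (2 * (K + 1))))%R ->
    (r * x <= / 4 /\ (K + 1) * x < d / 2)%R).
  { intros x Hx.
    assert (H1 : (x < / (4 * r))%R) by (apply Rlt_le_trans with (1 := Hx), Rmin_l).
    assert (H2 : (x < d / (2 * (K + 1)))%R) by (apply Rlt_le_trans with (1 := Hx), Rmin_r).
    apply (Rmult_lt_compat_l r) in H1; [|lra].
    apply (Rmult_lt_compat_l (K + 1)) in H2; [|lra].
    replace (r * / (4 * r))%R with (/ 4)%R in H1 by (field; lra).
    replace ((K + 1) * (d / (2 * (K + 1))))%R with (d / 2)%R in H2 by (field; lra).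
    lra. }
  intros t w Ht Hw.
  destruct (Hsm _ Ht) as [H1 H2]. destruct (Hsm _ Hw) as [H3 H4].
  assert (H := has_expansion_near_0 F c M r t w HF H1 H3). fold K in H.
  pose proof (Rabs_pos t). pose proof (Cmod_ge_0 w). lra.
Qed.

Lemma has_expansion_small F c M r d :
  has_expansion F c M r -> F 0%R 0 = 0 -> (0 < d)%R ->
  exists e, (0 < e)%R /\ forall t w,
    (Rabs t < e)%R -> (Cmod w < e)%R -> (Cmod (F t w) < d)%R.
Proof.
  intros HF H0 Hd. destruct (has_expansion_continuous F c M r d HF Hd) as [e [He H]].
  exists e. split; auto. intros t w Ht Hw. specialize (H t w Ht Hw).
  rewrite H0 in H. replace (F t w - 0) with (F t w) in H by ring. auto.
Qed.

Lemma Cmult_conj_Cmod2 (z : C) : z * Cconj z = RtoC (Re z ^ 2 + Im z ^ 2)%R.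
Proof. rewrite <- Cmod2_conj, <- Cmod2_alt, RtoC_pow. auto. Qed.

Lemma Cconj_csqrt_nonneg t : (0 <= t)%R -> Cconj (csqrt t) = csqrt t.
Proof.
  intros Ht. unfold csqrt, Cconj; simpl. rewrite (sqrt_neg_0 (- t)) by lra.
  f_equal; ring.
Qed.

Lemma Cconj_csqrt_neg t : (t < 0)%R -> Cconj (csqrt t) = - csqrt t.
Proof.
  intros Ht. unfold csqrt, Cconj, Copp; simpl. rewrite (sqrt_neg_0 t) by lra.
  f_equal; ring.
Qed.

Lemma Cconj_csqrt t : Cconj (csqrt t) = csqrt t \/ Cconj (csqrt t) = - csqrt t.
Proof.
  destruct (Rle_lt_dec 0 t);
    auto using Cconj_csqrt_nonneg, Cconj_csqrt_neg.
Qed.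

(** The points [+-sqrt eta] are real and fixed or imaginary and exchanged; either
    way the map acts on them as complex conjugation. *)
Lemma acts_as_conjugation f :
  fixed_points_at_sqrt f ->
  locally 0%R (fun t => t <> 0%R ->
    f t (csqrt t) = Cconj (csqrt t) /\ f t (- csqrt t) = Cconj (- csqrt t)).
Proof.
  intros [Hfix Hper].
  destruct (near_origin_Cmod _ Hfix) as [d [Hd H]].
  generalize (filter_and _ _ Hper (filter_and _ _ (locally_Rabs_lt d Hd)
    (locally_on_axis_sqrt_small d Hd))).
  apply filter_imp. intros t [H1 [H2 H3]] Ht.
  assert (Hs := H3 _ (on_axis_sqrt_csqrt t)).
  assert (Hs' := H3 _ (on_axis_sqrt_opp _ _ (on_axis_sqrt_csqrt t))).
  destruct (Rle_lt_dec 0 t) as [Hp|Hn].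
  - assert (E := Cconj_csqrt_nonneg t Hp).
    split.
    + rewrite E. apply (proj2 (H t _ H2 Hs)). auto.
    + rewrite Copp_conj, E. apply (proj2 (H t _ H2 Hs')). auto.
  - assert (E := Cconj_csqrt_neg t Hn).
    destruct (H1 Hn) as [H4 H5]. split.
    + rewrite E. auto.
    + rewrite Copp_conj, E, H5. ring.
Qed.

(** For small [t > 0] both square roots of [t] are real and fixed, so
    [F(s^2, s) = s] for [F(t, w) = f_t(conj w)]: the odd part of the left-hand
    side divided by [s] is the constant 1 for [t > 0].  Its derivative in [t] at
    0, which is the sum of the coefficients of [t w] and [w^3], vanishes. *)
Lemma odd_part_identity f c M r :
  has_expansion (conj_variable f) c M r -> c O 1%nat = 1 ->
  fixed_points_at_sqrt f -> c 1%nat 1%nat = - c O 3%nat.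
Proof.
  intros HF Hc1 Hfix. pose proof HF as [Hr [Hc Hexp]].
  assert (Hodd := double_bounded_odd c M r Hc Hr).
  assert (Hr2 : (0 < r ^ 2)%R) by (apply pow_lt; lra).
  assert (Hone : exists d, (0 < d)%R /\ forall t, (0 < t < d)%R ->
    diagonal (odd_columns c) t = 1).
  { assert (Hpos : (0 < / (4 * r))%R) by (apply Rinv_0_lt_compat; lra).
    assert (L := filter_and _ _ (acts_as_conjugation f Hfix)
      (filter_and _ _ (locally_on_axis_sqrt_small _ Hpos) (locally_Rabs_lt _ Hpos))).
    apply locally_0_abs in L. destruct L as [d [Hd L]]. exists d. split; auto.
    intros t Ht. destruct (L t) as [H1 [H2 H3]].
    { rewrite Rabs_pos_eq; lra. }
    destruct (H1 ltac:(lra)) as [H4 H5].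
    assert (Hs := on_axis_sqrt_csqrt t).
    assert (Hs' := on_axis_sqrt_opp _ _ Hs).
    assert (Hle : forall x, (x < / (4 * r))%R -> (r * x <= / 4)%R).
    { intros x Hx. left. apply (Rmult_lt_compat_l r) in Hx; [|lra].
      replace (r * / (4 * r))%R with (/ 4)%R in Hx by (field; lra). auto. }
    assert (Hm := Hle _ (H2 _ Hs)). assert (Hm' := Hle _ (H2 _ Hs')).
    apply Hle in H3.
    assert (E := Cconj_csqrt_nonneg t ltac:(lra)).
    assert (Ev : forall s, r * Cmod s <= / 4 -> s ^ 2 = RtoC t ->
      f t (Cconj s) = diagonal (even_columns c) t + s * diagonal (odd_columns c) t).
    { intros s Hsm Hss. change (f t (Cconj s)) with (conj_variable f t s).
      rewrite Hexp by auto. apply (CPSeries_slice_even_odd c M r); auto; lra. }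
    assert (E1 := Ev _ Hm (on_axis_sqrt_sq _ _ Hs)).
    assert (E2 := Ev _ Hm' (on_axis_sqrt_sq _ _ Hs')).
    rewrite E, H4, E in E1. rewrite Copp_conj, E, H5, Copp_conj, E in E2.
    assert (Hne : csqrt t <> 0).
    { intros E0. apply on_axis_sqrt_sq in Hs. rewrite E0 in Hs.
      assert (RtoC 0 = RtoC t) by (rewrite <- Hs; simpl; ring).
      apply RtoC_inj in H. lra. }
    set (s := csqrt t) in *. set (o := diagonal (odd_columns c) t) in *.
    set (e := diagonal (even_columns c) t) in *.
    assert (E3 : 2 * s * (o - 1) = 0).
    { replace (2 * s * (o - 1)) with ((e + s * o) - s - ((e + - s * o) - - s)) by ring.
      rewrite <- E1, <- E2. ring. }
    assert (E4 : o - 1 = 0).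
    { replace (o - 1) with (2 * s * (o - 1) * (/ 2 * / s)).
      rewrite E3; ring. field. auto. }
    replace o with (o - 1 + 1) by ring. rewrite E4. ring. }
  destruct Hone as [d [Hd Hone]].
  destruct (analytic_diagonal_Re _ _ _ Hodd Hr2) as [_ [V1 D1]].
  destruct (analytic_diagonal_Im _ _ _ Hodd Hr2) as [_ [V2 D2]].
  change (odd_columns c 0 0) with (c 0%nat 1%nat) in V1, V2. rewrite Hc1 in V1, V2.
  change (odd_columns c 1 0) with (c 1%nat 1%nat) in D1, D2.
  change (odd_columns c 0 1) with (c 0%nat 3%nat) in D1, D2.
  apply right_constant_derive in D1.
  2:{ exists d. split; auto. intros x Hx. destruct (Req_dec x 0) as [->|Hne]; auto.
      rewrite V1, Hone by lra. auto. }
  apply right_constant_derive in D2.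
  2:{ exists d. split; auto. intros x Hx. destruct (Req_dec x 0) as [->|Hne]; auto.
      rewrite V2, Hone by lra. auto. }
  rewrite (surjective_pairing (c 1%nat 1%nat)), (surjective_pairing (c O 3%nat)).
  unfold Copp; simpl. unfold Re, Im in D1, D2. f_equal; lra.
Qed.

(** On the positive real axis conjugation is invisible, and there the
    normal form determines the coefficients. *)
Lemma normal_form_coefficients f0 f b0 c M r :
  has_expansion (conj_variable f) c M r -> has_formal_invariant f0 b0 ->
  locally (RtoC 0) (fun z => f 0%R z = f0 z) ->
  c O 1%nat = 1 /\ c O 2%nat = / 2 /\ c O 3%nat = / 4 - RtoC b0 / 2.
Proof.
  intros [Hr [Hc Hexp]] Hb0 Heq.
  assert (Hd : Cgeom (fun k => c O k) M r) by (intros k; apply Hc).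
  destruct (coefficients_of_cubic_expansion _ M r 0 1 (/ 2) (/ 4 - RtoC b0 / 2) Hd
    ltac:(lra)) as [_ H]; auto.
  intros eps Heps.
  destruct (locally_C_Cmod _ (Hb0 (mkposreal eps Heps))) as [d1 [Hd1 H1]].
  destruct (locally_C_Cmod _ Heq) as [d2 [Hd2 H2]].
  exists (Rmin (Rmin d1 d2) (/ (4 * r))).
  split; [repeat apply Rmin_glb_lt; auto; apply Rinv_0_lt_compat; lra|].
  intros x [Hx Hxd].
  assert (L1 : (x < d1)%R).
  { apply Rlt_le_trans with (1 := Hxd). eapply Rle_trans; [apply Rmin_l|apply Rmin_l]. }
  assert (L2 : (x < d2)%R).
  { apply Rlt_le_trans with (1 := Hxd). eapply Rle_trans; [apply Rmin_l|apply Rmin_r]. }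
  assert (L3 : (x < / (4 * r))%R) by (apply Rlt_le_trans with (1 := Hxd), Rmin_r).
  assert (Hmod : Cmod (RtoC x) = x) by (rewrite Cmod_R, Rabs_pos_eq; lra).
  assert (Ec : Cconj (RtoC x) = RtoC x).
  { unfold Cconj, RtoC; simpl. f_equal; ring. }
  specialize (H1 (RtoC x) ltac:(lra)). specialize (H2 (RtoC x) ltac:(lra)).
  assert (Hval : f0 (RtoC x) = CPSeries (fun k => c O k) (RtoC x)).
  { rewrite <- H2, <- Ec. change (f 0%R (Cconj (RtoC x))) with (conj_variable f 0%R (RtoC x)).
    rewrite Ec, Hexp.
    - apply CSeries_ext. intros k. f_equal.
      assert (H3 := slice_near_0 c M r 0 k Hc ltac:(lra)).
      rewrite Rabs_R0, !Rmult_0_r in H3. specialize (H3 ltac:(lra)).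
      assert (E : slice c 0 k - c O k = 0).
      { apply Cmod_eq_0. apply Rle_antisym; auto. apply Cmod_ge_0. }
      replace (slice c 0 k) with (slice c 0 k - c O k + c O k) by ring.
      rewrite E. ring.
    - rewrite Rabs_R0. lra.
    - rewrite Hmod. left. apply (Rmult_lt_compat_l r) in L3; [|lra].
      replace (r * / (4 * r))%R with (/ 4)%R in L3 by (field; lra). auto. }
  rewrite Ec, Hval in H1.
  change (Cmod (CPSeries (fun k => c O k) (RtoC x) -
    (RtoC x + / 2 * RtoC x ^ 2 + (/ 4 - RtoC b0 / 2) * RtoC x ^ 3))
    <= eps * Cmod (RtoC x ^ 3))%R in H1.
  rewrite Cmod_pow, Hmod in H1.
  eapply Rle_trans; [|apply H1]. right. f_equal. ring.
Qed.

(** The multiplier at [s = +-sqrt t] is [D(t, s) * conj (D(t, conj s))].  Writing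
    [D(t, s) = U + s V] and, as [conj s] is also a square root of [t],
    [D(t, conj s) = U + conj s V], it equals
    [(U + s V) (conj U + s conj V)], whose even and odd parts in [s] are real. *)
Lemma multiplier_expansion f0 f b0 :
  has_formal_invariant f0 b0 -> unfolding f0 f -> fixed_points_at_sqrt f ->
  exists A B : R -> R,
    analytic A /\ analytic B /\ A 0%R = 1%R /\ B 0%R = 2%R /\
    is_derive A 0%R (2 - 2 * b0)%R /\
    locally 0%R (fun t => t <> 0%R ->
      taylor2 (second_iterate f t) (csqrt t) (RtoC (A t) + csqrt t * RtoC (B t)) /\
      taylor2 (second_iterate f t) (- csqrt t) (RtoC (A t) + - csqrt t * RtoC (B t))).
Proof.
  intros Hb0 [[Han [Hf0 _]] Heq] Hfix.
  destruct (mix_anti_analytic_expansion f Han) as [c [M [r HF]]].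
  destruct (normal_form_coefficients f0 f b0 c M r HF Hb0 Heq) as [C1 [C2 C3]].
  assert (C4 := odd_part_identity f c M r HF C1 Hfix).
  pose proof HF as [Hr [Hc Hexp]].
  assert (Hc' := double_bounded_derive c M r Hc ltac:(lra)).
  assert (Hev := double_bounded_even _ _ _ Hc' ltac:(lra)).
  assert (Hod := double_bounded_odd _ _ _ Hc' ltac:(lra)).
  assert (Hr2 : (0 < (2 * r) ^ 2)%R) by (apply pow_lt; lra).
  set (U := diagonal (even_columns (double_derive c))).
  set (V := diagonal (odd_columns (double_derive c))).
  destruct (analytic_diagonal_Re _ _ _ Hev Hr2) as [U1 [U1v U1d]].
  destruct (analytic_diagonal_Im _ _ _ Hev Hr2) as [U2 [U2v U2d]].
  destruct (analytic_diagonal_Re _ _ _ Hod Hr2) as [V1 [V1v V1d]].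
  destruct (analytic_diagonal_Im _ _ _ Hod Hr2) as [V2 [V2v V2d]].
  change (diagonal (even_columns (double_derive c))) with U
    in U1, U1v, U1d, U2, U2v, U2d.
  change (diagonal (odd_columns (double_derive c))) with V
    in V1, V1v, V1d, V2, V2v, V2d.
  assert (D0 : double_derive c 0 0 = 1).
  { unfold double_derive. rewrite C1. simpl. ring. }
  assert (D1 : double_derive c 0 1 = 1).
  { unfold double_derive. rewrite C2. simpl. rewrite RtoC_plus. field. }
  (* The first Taylor coefficient of [U]: that of [t w] plus three times that of
     [w^3], hence twice that of [w^3]. *)
  assert (D2 : double_derive c 1 0 + double_derive c 0 2 = / 2 - RtoC b0).
  { unfold double_derive. rewrite C3, C4, C3. simpl. rewrite !RtoC_plus. field. }
  change (even_columns (double_derive c) 0 0) with (double_derive c 0 0) in U1v, U2v.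
  change (even_columns (double_derive c) 1 0) with (double_derive c 1 0) in U1d.
  change (even_columns (double_derive c) 0 1) with (double_derive c 0 2) in U1d.
  change (odd_columns (double_derive c) 0 0) with (double_derive c 0 1) in V1v, V2v.
  rewrite D0 in U1v, U2v. rewrite D1 in V1v, V2v.
  change (Re 1) with 1%R in U1v, V1v. change (Im 1) with 0%R in U2v, V2v.
  assert (U1d' : is_derive (fun t => Re (U t)) 0%R (/ 2 - b0)%R).
  { replace (/ 2 - b0)%R with (Re (/ 2 - RtoC b0)).
    - rewrite <- D2. exact U1d.
    - rewrite <- RtoC_inv, <- RtoC_minus by lra. auto. }
  assert (Hsq : forall u, analytic u -> analytic (fun x => u x ^ 2)%R).
  { intros u Hu. apply analytic_ext with (fun x => u x * u x)%R.
    intros; ring. apply analytic_mult; auto. }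
  exists (fun t => (Re (U t) ^ 2 + Im (U t) ^ 2) + t * (Re (V t) ^ 2 + Im (V t) ^ 2))%R,
    (fun t => 2 * (Re (U t) * Re (V t) + Im (U t) * Im (V t)))%R.
  split; [|split; [|split; [|split; [|split]]]].
  - apply analytic_plus; [apply analytic_plus; auto|].
    apply analytic_mult; [apply analytic_id|apply analytic_plus; auto].
  - apply analytic_scal, analytic_plus; apply analytic_mult; auto.
  - rewrite U1v, U2v. ring.
  - rewrite U1v, U2v, V1v, V2v. ring.
  - destruct (analytic_is_derive _ V1) as [v1 Hv1].
    destruct (analytic_is_derive _ V2) as [v2 Hv2].
    set (u1 := fun t => Re (U t)) in *. set (u2 := fun t => Im (U t)) in *.
    set (w1 := fun t => Re (V t)) in *. set (w2 := fun t => Im (V t)) in *.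
    change (u1 0%R = 1%R) in U1v. change (u2 0%R = 0%R) in U2v.
    change (w1 0%R = 1%R) in V1v. change (w2 0%R = 0%R) in V2v.
    change (is_derive (fun t => (u1 t ^ 2 + u2 t ^ 2) + t * (w1 t ^ 2 + w2 t ^ 2))%R
      0%R (2 - 2 * b0)%R).
    auto_derive.
    + repeat split; eexists; eassumption.
    + change (Derive (fun x => u1 x) 0%R) with (Derive u1 0%R).
      rewrite (is_derive_unique u1 _ _ U1d'), U1v, U2v, V1v, V2v. field.
  - assert (Hpos : (0 < / (8 * r))%R) by (apply Rinv_0_lt_compat; lra).
    generalize (filter_and _ _ (acts_as_conjugation f Hfix)
      (filter_and _ _ (locally_on_axis_sqrt_small _ Hpos) (locally_Rabs_lt _ Hpos))).
    apply filter_imp. intros t [H1 [H2 H3]] Ht. destruct (H1 Ht) as [H4 H5].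
    assert (Hle : forall x, (x < / (8 * r))%R -> (2 * r * x < / 4)%R).
    { intros x Hx. apply (Rmult_lt_compat_l (2 * r)) in Hx; [|lra].
      replace (2 * r * / (8 * r))%R with (/ 4)%R in Hx by (field; lra). auto. }
    apply Hle in H3. pose proof (Rabs_pos t).
    assert (Key : forall s, on_axis_sqrt t s -> f t s = Cconj s ->
      taylor2 (second_iterate f t) s
        (RtoC (Re (U t) ^ 2 + Im (U t) ^ 2 + t * (Re (V t) ^ 2 + Im (V t) ^ 2))
         + s * RtoC (2 * (Re (U t) * Re (V t) + Im (U t) * Im (V t))))).
    { intros s Hs Hfs. assert (Hm := Hle _ (H2 _ Hs)). pose proof (Cmod_ge_0 s).
      assert (Hss := on_axis_sqrt_sq _ _ Hs).
      assert (HT := taylor2_second_iterate f c M r t s HF).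
      rewrite Hfs, Cmod_conj, Cconj_conj in HT.
      specialize (HT ltac:(lra) ltac:(lra) ltac:(lra)).
      assert (E1 : partial_w c t s = U t + s * V t).
      { apply (CPSeries_slice_even_odd _ (2 * M * r) (2 * r)); auto; lra. }
      assert (E2 : partial_w c t (Cconj s) = U t + Cconj s * V t).
      { apply (CPSeries_slice_even_odd _ (2 * M * r) (2 * r)); auto; try lra.
        - rewrite Cmod_conj; lra.
        - rewrite <- Cpow_conj, Hss. unfold Cconj, RtoC; simpl. f_equal; ring. }
      rewrite E1, E2, Cplus_conj, Cmult_conj, Cconj_conj in HT.
      replace (RtoC _ + s * RtoC _) with ((U t + s * V t) * (Cconj (U t) + s * Cconj (V t)));
        auto.
      rewrite RtoC_plus, RtoC_mult, <- !Cmult_conj_Cmod2, <- Hss.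
      replace (RtoC (2 * (Re (U t) * Re (V t) + Im (U t) * Im (V t))))
        with (U t * Cconj (V t) + V t * Cconj (U t)); [ring|].
      unfold Cconj, RtoC, Cmult, Cplus, Re, Im; simpl. f_equal; ring. }
    split; apply Key; auto using on_axis_sqrt_csqrt, on_axis_sqrt_opp.
Qed.

(** * Invariance *)

Lemma conj_variable_small f c M r d :
  has_expansion (conj_variable f) c M r -> f 0%R 0 = 0 -> (0 < d)%R ->
  exists e, (0 < e)%R /\ forall t z,
    (Rabs t < e)%R -> (Cmod z < e)%R -> (Cmod (f t z) < d)%R.
Proof.
  intros HF H0 Hd.
  destruct (has_expansion_small _ c M r d HF) as [e [He H]]; auto.
  { unfold conj_variable. replace (Cconj 0) with (RtoC 0); auto.
    unfold Cconj, RtoC; simpl. f_equal; ring. }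
  exists e. split; auto. intros t z Ht Hz.
  rewrite <- (Cconj_conj z). apply (H t (Cconj z)); auto. rewrite Cmod_conj; auto.
Qed.

(** The derivative depends continuously on parameter and point, and it is
    non-zero at the origin. *)
Lemma mix_analytic_change_derive h :
  mix_analytic_change h ->
  exists e, (0 < e)%R /\ forall t z, (Rabs t < e)%R -> (Cmod z < e)%R ->
    exists l : C, l <> 0 /\ taylor2 (h t) z l.
Proof.
  intros [Han [_ [l [Hl Hl0]]]].
  destruct (mix_analytic_expansion h Han) as [c [M [r HF]]].
  pose proof HF as [Hr [Hc _]].
  assert (HD : has_expansion (partial_w c) (double_derive c) (2 * M * r) (2 * r)).
  { split; [lra|split; auto]. apply double_bounded_derive; auto; lra. }
  assert (E : partial_w c 0%R 0 = l).
  { apply is_C_derive_unique in Hl. rewrite <- Hl. symmetry.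
    apply is_C_derive_unique, taylor2_is_derive.
    apply (has_expansion_taylor2 h c M r); auto.
    - rewrite Rabs_R0; lra.
    - rewrite Cmod_0; lra. }
  destruct (has_expansion_continuous _ _ _ _ (Cmod l) HD) as [e [He H]].
  { apply Cmod_gt_0; auto. }
  exists (Rmin e (/ (4 * r))).
  split; [apply Rmin_glb_lt; auto; apply Rinv_0_lt_compat; lra|].
  assert (Hsm : forall x, (x < Rmin e (/ (4 * r)))%R -> (x < e /\ r * x < / 4)%R).
  { intros x Hx. split; [apply Rlt_le_trans with (1 := Hx), Rmin_l|].
    assert (H1 : (x < / (4 * r))%R) by (apply Rlt_le_trans with (1 := Hx), Rmin_r).
    apply (Rmult_lt_compat_l r) in H1; [|lra].
    replace (r * / (4 * r))%R with (/ 4)%R in H1 by (field; lra). auto. }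
  intros t z Ht Hz. destruct (Hsm _ Ht) as [T1 T2]. destruct (Hsm _ Hz) as [Z1 Z2].
  exists (partial_w c t z). split.
  - intros E0. specialize (H t z T1 Z1). rewrite E, E0 in H.
    replace (0 - l) with (- l) in H by ring. rewrite Cmod_opp in H. lra.
  - apply (has_expansion_taylor2 h c M r); auto. lra.
Qed.

Lemma second_iterate_derivable f :
  mix_anti_analytic_at f 0 0 -> f 0%R 0 = 0 ->
  exists e, (0 < e)%R /\ forall t z, (Rabs t < e)%R -> (Cmod z < e)%R ->
    exists m, taylor2 (second_iterate f t) z m.
Proof.
  intros Han Hf0. destruct (mix_anti_analytic_expansion f Han) as [c [M [r HF]]].
  pose proof HF as [Hr _].
  assert (Hpos : (0 < / (4 * r))%R) by (apply Rinv_0_lt_compat; lra).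
  destruct (conj_variable_small f c M r _ HF Hf0 Hpos) as [e [He H]].
  assert (Hsm : forall x, (x < / (4 * r))%R -> (r * x < / 4)%R).
  { intros x H1. apply (Rmult_lt_compat_l r) in H1; [|lra].
    replace (r * / (4 * r))%R with (/ 4)%R in H1 by (field; lra). auto. }
  exists (Rmin e (/ (4 * r))). split; [apply Rmin_glb_lt; auto|].
  intros t z Ht Hz. eexists. apply (taylor2_second_iterate f c M r); auto.
  - left. apply Hsm, Rlt_le_trans with (1 := Ht), Rmin_r.
  - apply Hsm, Rlt_le_trans with (1 := Hz), Rmin_r.
  - apply Hsm, H.
    + apply Rlt_le_trans with (1 := Ht), Rmin_l.
    + apply Rlt_le_trans with (1 := Hz), Rmin_l.
Qed.

(** The change of coordinate conjugates the second iterates, and its own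
    derivative cancels in the chain rule at a fixed point. *)
Lemma multiplier_conjugacy_invariant f f' h :
  mix_anti_analytic_diffeo f -> mix_anti_analytic_diffeo f' ->
  mix_analytic_change h -> conjugate_by h f f' ->
  exists e, (0 < e)%R /\ forall t z m, (Rabs t < e)%R -> (Cmod z < e)%R ->
    second_iterate f t z = z -> taylor2 (second_iterate f t) z m ->
    taylor2 (second_iterate f' t) (h t z) m.
Proof.
  intros [Hf [Hf0 _]] [Hf' [Hf'0 _]] Hh Hconj.
  destruct (near_origin_Cmod (fun t z => f' t (h t z) = h t (f t z)) Hconj) as [e1 [He1 H1]].
  destruct (mix_anti_analytic_expansion f Hf) as [c [M [r HF]]].
  destruct (conj_variable_small f c M r _ HF Hf0 He1) as [e2 [He2 H2]].
  destruct (mix_analytic_change_derive h Hh) as [e3 [He3 H3]].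
  destruct (second_iterate_derivable f' Hf' Hf'0) as [e4 [He4 H4]].
  destruct Hh as [Hh [Hh0 _]].
  destruct (mix_analytic_expansion h Hh) as [ch [Mh [rh Hhe]]].
  destruct (has_expansion_small h ch Mh rh _ Hhe Hh0 He4) as [e5 [He5 H5]].
  set (e := Rmin (Rmin e1 e2) (Rmin e3 (Rmin e4 e5))).
  assert (He : forall x, (x < e)%R -> (x < e1 /\ x < e2 /\ x < e3 /\ x < e4 /\ x < e5)%R).
  { intros x Hx. unfold e in Hx.
    apply Rmin_Rgt_l in Hx as [Ha Hb]. apply Rmin_Rgt_l in Ha as [A1 A2].
    apply Rmin_Rgt_l in Hb as [B1 Hb]. apply Rmin_Rgt_l in Hb as [B2 B3].
    repeat split; lra. }
  exists e. split; [unfold e; repeat apply Rmin_glb_lt; auto|].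
  intros t z m Ht Hz Hfixed Hm.
  destruct (He _ Ht) as [T1 [T2 [T3 [T4 T5]]]].
  destruct (He _ Hz) as [Z1 [Z2 [Z3 [Z4 Z5]]]].
  destruct (H3 t z T3 Z3) as [l [Hl0 Hl]].
  destruct (H4 t (h t z) T4 (H5 t z T5 Z5)) as [m' Hm'].
  assert (K1 := taylor2_comp _ _ _ _ _ Hl Hm').
  assert (K2 : taylor2 (fun x => h t (second_iterate f t x)) z (l * m)).
  { apply taylor2_comp; auto. rewrite Hfixed. auto. }
  assert (K3 : taylor2 (fun x => second_iterate f' t (h t x)) z (l * m)).
  { apply (taylor2_ext_loc _ _ _ _ (e - Cmod z)%R ltac:(lra)) with (2 := K2).
    intros x Hx. assert (Hxe : (Cmod x < e)%R).
    { replace x with (z + (x - z)) by ring.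
      apply Rle_lt_trans with (1 := Cmod_triangle _ _). lra. }
    destruct (He _ Hxe) as [X1 [X2 _]].
    unfold second_iterate. rewrite H1, H1; auto. }
  assert (E := taylor2_unique _ _ _ _ K1 K3).
  replace m with m'; auto.
  replace m' with (m' * l * / l) by (field; auto). rewrite E. field. auto.
Qed.

(** * The canonical parameter and the formal invariant *)

Lemma eps_b_of_multipliers (g : C -> C) (p q m1 m2 : C) :
  taylor2 g p m1 -> taylor2 g q m2 ->
  (0 < Re m1)%R -> (0 < Re m2)%R -> Clog m1 <> 0 -> Clog m2 <> 0 ->
  / Clog m1 - / Clog m2 <> 0 ->
  eps_b_defined g p q /\
  eps_of g p q = / ((/ Clog m1 - / Clog m2) ^ 2) /\
  b_of g p q = / Clog m1 + / Clog m2.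
Proof.
  intros T1 T2 R1 R2 L1 L2 L12.
  apply taylor2_is_derive in T1. apply taylor2_is_derive in T2.
  assert (E1 := is_C_derive_unique _ _ _ T1).
  assert (E2 := is_C_derive_unique _ _ _ T2).
  unfold eps_b_defined, log_mult_defined, eps_of, b_of, log_mult.
  rewrite E1, E2.
  repeat split; auto; try (intros [_ Hneg]; lra); eexists; eassumption.
Qed.

Lemma second_iterate_fixes_csqrt f t :
  f t (csqrt t) = Cconj (csqrt t) -> f t (- csqrt t) = Cconj (- csqrt t) ->
  second_iterate f t (csqrt t) = csqrt t /\
  second_iterate f t (- csqrt t) = - csqrt t.
Proof.
  intros F1 F2. unfold second_iterate. rewrite F1, F2, Copp_conj in *.
  destruct (Cconj_csqrt t) as [E|E]; rewrite E in *.
  - auto.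
  - replace (- - csqrt t) with (csqrt t) in * by ring. rewrite F1, F2. auto.
Qed.

Theorem theorem3p3p2 (f0 : C -> C) (b0 : R) (f : R -> C -> C)
  (Hpar : antiholomorphic_parabolic_codim1 f0)
  (Hb0 : has_formal_invariant f0 b0)
  (Hunf : unfolding f0 f)
  (Hgen : generic f0 f)
  (Hfix : fixed_points_at_sqrt f) :
  let g := second_iterate f in
  let eps := fun eta : R => eps_of (g eta) (csqrt eta) (- csqrt eta) in
  let b := fun eta : R => b_of (g eta) (csqrt eta) (- csqrt eta) in
  locally' 0%R (fun eta : R =>
    eps_b_defined (g eta) (csqrt eta) (- csqrt eta)) /\
  locally' 0%R (fun eta : R => Im (eps eta) = 0%R /\ Im (b eta) = 0%R) /\
  (forall h f' : R -> C -> C,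
    mix_analytic_change h ->
    mix_anti_analytic_diffeo f' ->
    conjugate_by h f f' ->
    let g' := second_iterate f' in
    locally' 0%R (fun eta : R =>
      let p := h eta (csqrt eta) in
      let q := h eta (- csqrt eta) in
      eps_b_defined (g' eta) p q /\
      eps_of (g' eta) p q = eps eta /\ b_of (g' eta) p q = b eta)) /\
  (exists E B : R -> R,
    real_analytic_at E 0 /\ real_analytic_at B 0 /\
    locally' 0%R (fun eta : R => eps eta = RtoC (E eta) /\
                                 b eta = RtoC (B eta)) /\
    E 0%R = 0%R /\ B 0%R = b0).
Proof.
  intros g eps b.
  destruct (multiplier_expansion f0 f b0 Hb0 Hunf Hfix)
    as [A [B [HA [HB [HA0 [HB0 [HdA HT]]]]]]].
  destruct (canonical_invariants A B _ HA HB HA0 HB0 HdA)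
    as [E [H [HE [HH [HE0 [HH0 HEH]]]]]].
  assert (L := filter_and _ _ HT HEH).
  assert (Hmain : locally' 0%R (fun eta =>
    eps_b_defined (g eta) (csqrt eta) (- csqrt eta) /\
    eps eta = RtoC (E eta) /\ b eta = RtoC (H eta))).
  { revert L. unfold locally', within. apply filter_imp.
    intros t [K1 K2] Ht. destruct (K1 Ht) as [T1 T2].
    destruct (K2 Ht _ (on_axis_sqrt_csqrt t)) as [M1 [M2 [M3 [M4 [M5 [M6 M7]]]]]].
    unfold eps, b. rewrite <- M6, <- M7. apply eps_b_of_multipliers; auto. }
  split; [|split; [|split]].
  - revert Hmain. apply filter_imp. intros t [K _]. exact K.
  - revert Hmain. apply filter_imp. intros t [_ [K1 K2]]. rewrite K1, K2. auto.
  - intros h f' Hh Hf' Hconj g'.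
    destruct Hunf as [Hf _].
    destruct (multiplier_conjugacy_invariant f f' h Hf Hf' Hh Hconj) as [e [He Hinv]].
    generalize (filter_and _ _ L (filter_and _ _ (acts_as_conjugation f Hfix)
      (filter_and _ _ (locally_on_axis_sqrt_small e He) (locally_Rabs_lt e He)))).
    unfold locally', within. apply filter_imp.
    intros t [[K1 K2] [K3 [K4 K5]]] Ht.
    destruct (K1 Ht) as [T1 T2]. destruct (K3 Ht) as [F1 F2].
    destruct (K2 Ht _ (on_axis_sqrt_csqrt t)) as [M1 [M2 [M3 [M4 [M5 _]]]]].
    assert (S1 := on_axis_sqrt_csqrt t). assert (S2 := on_axis_sqrt_opp _ _ S1).
    destruct (eps_b_of_multipliers _ _ _ _ _ T1 T2 M1 M2 M3 M4 M5) as [_ [G1 G2]].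
    unfold eps, b, g. rewrite G1, G2.
    destruct (second_iterate_fixes_csqrt f t F1 F2) as [F1' F2'].
    apply eps_b_of_multipliers; auto; apply Hinv; auto.
  - exists E, H. split; [auto|split; [auto|split; [|split]]]; auto.
    + revert Hmain. apply filter_imp. intros t [_ K]. exact K.
    + rewrite HH0. field.
Qed.
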